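(* Let $K$ be an algebraically closed field of characteristic zero and let $S\subset\mathbb{P}^3_K$ be a smooth cubic surface. The stabilizer $\mathrm{Stab}(S)=\{M\in\mathrm{PGL}_4(K)\mid M(S)=S\}$ is non-trivial if and only if $S$ has at least one Eckardt point.
   Context: A point of a smooth cubic surface $S\subset\mathbb{P}^3_K$ is an Eckardt point if it is the intersection of three (necessarily coplanar) lines of $S$. $\mathrm{PGL}_4(K)$ acts on $\mathbb{P}^3_K$ in the canonical way. *)

(* Defs.v *)
From HB Require Import structures.
From mathcomp Require Import all_boot all_order all_algebra.
From mathcomp Require Import generic_quotient classical_sets.
From mathcomp Require Import ssrcomplements freeg mpoly.

Set Implicit Arguments.
Unset Strict Implicit.
Unset Printing Implicit Defensive.

Import GRing.Theory.

Local Open Scope ring_scope.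

Section GeneralLinear.
Variables (K : fieldType) (n : nat).

Definition GL : Type := {M : 'M[K]_n | M \in unitmx}.

HB.instance Definition _ := SubChoice.on GL.

Implicit Types A B C : GL.

Lemma GL_unit A : val A \in unitmx.
Proof. exact: valP A. Qed.

Lemma GL_mul_subproof A B : val A *m val B \in unitmx.
Proof. by rewrite unitmx_mul !GL_unit. Qed.

Lemma GL_inv_subproof A : invmx (val A) \in unitmx.
Proof. by rewrite unitmx_inv GL_unit. Qed.

Definition GL_one : GL := Sub 1%:M (unitmx1 K n).
Definition GL_mul A B : GL := Sub (val A *m val B) (GL_mul_subproof A B).
Definition GL_inv A : GL := Sub (invmx (val A)) (GL_inv_subproof A).

Fact GL_mulA : associative GL_mul.
Proof. by move=> A B C; apply: val_inj; rewrite /= mulmxA. Qed.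

Fact GL_mul1g : left_id GL_one GL_mul.
Proof. by move=> A; apply: val_inj; rewrite /= mul1mx. Qed.

Fact GL_mulg1 : right_id GL_one GL_mul.
Proof. by move=> A; apply: val_inj; rewrite /= mulmx1. Qed.

Fact GL_mulVg : left_inverse GL_one GL_inv GL_mul.
Proof. by move=> A; apply: val_inj; rewrite /= mulVmx ?GL_unit. Qed.

Fact GL_mulgV : right_inverse GL_one GL_inv GL_mul.
Proof. by move=> A; apply: val_inj; rewrite /= mulmxV ?GL_unit. Qed.

HB.instance Definition _ :=
  isGroup.Build GL GL_mulA GL_mul1g GL_mulg1 GL_mulVg GL_mulgV.

(* Equality modulo the subgroup of scalar matrices. *)
Definition GL_proj_eq A B : bool := is_scalar_mx (val (A^-1 * B)%g).

Lemma GL_proj_eqP A B :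
  reflect (exists a : K, val B = a *: val A) (GL_proj_eq A B).
Proof.
apply: (iffP is_scalar_mxP) => -[a].
  move=> /= E; exists a; rewrite -mul_mx_scalar -E mulmxA mulmxV ?GL_unit //.
  by rewrite mul1mx.
by move=> /= ->; exists a; rewrite -scalemxAr mulVmx ?GL_unit // scalemx1.
Qed.

Fact GL_proj_eq_refl : reflexive GL_proj_eq.
Proof. by move=> A; apply/GL_proj_eqP; exists 1; rewrite scale1r. Qed.

Fact GL_proj_eq_sym : ssrbool.symmetric GL_proj_eq.
Proof.
suff H A B : GL_proj_eq A B -> GL_proj_eq B A.
  by move=> A B; apply/idP/idP => /H.
move=> /GL_proj_eqP[a E]; apply/GL_proj_eqP.
have [a0|an0] := eqVneq a 0; last first.
  by exists a^-1; rewrite E scalerA mulVf // scale1r.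
exists 0; rewrite scale0r -[LHS]mulmx1 -(mulVmx (GL_unit B)) {2}E a0 scale0r.
by rewrite !mulmx0.
Qed.

Fact GL_proj_eq_trans : transitive GL_proj_eq.
Proof.
move=> B A C /GL_proj_eqP[a E] /GL_proj_eqP[b F]; apply/GL_proj_eqP.
by exists (b * a); rewrite F E scalerA.
Qed.

Canonical GL_proj_equiv :=
  EquivRel GL_proj_eq GL_proj_eq_refl GL_proj_eq_sym GL_proj_eq_trans.

End GeneralLinear.

Section ProjectiveLinear.
Variables (K : fieldType) (n : nat).

Definition PGL : Type := {eq_quot @GL_proj_eq K n}%qT.

HB.instance Definition _ := Choice.on PGL.
HB.instance Definition _ := EqQuotient.on PGL.

Local Open Scope quotient_scope.

Implicit Types g h k : PGL.

Definition PGL_of (A : GL K n) : PGL := \pi_PGL A.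

Lemma PGL_of_eqP (A B : GL K n) :
  PGL_of A = PGL_of B <-> exists a : K, val B = a *: val A.
Proof. by split=> [/eqmodP/GL_proj_eqP|/GL_proj_eqP/eqmodP]. Qed.

Lemma PGL_ofK g : PGL_of (repr g) = g.
Proof. exact: reprK. Qed.

Lemma repr_PGL_of (A : GL K n) :
  exists a : K, val A = a *: val (repr (PGL_of A)).
Proof. by apply/PGL_of_eqP; rewrite PGL_ofK. Qed.

Definition PGL_one : PGL := PGL_of 1%g.
Definition PGL_mul g h : PGL := PGL_of (repr g * repr h)%g.
Definition PGL_inv g : PGL := PGL_of (repr g)^-1%g.

Lemma PGL_mulE (A B : GL K n) :
  PGL_mul (PGL_of A) (PGL_of B) = PGL_of (A * B)%g.
Proof.
apply/PGL_of_eqP; have [a Ea] := repr_PGL_of A; have [b Eb] := repr_PGL_of B.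
by exists (a * b); rewrite /= Ea Eb -scalemxAl -scalemxAr scalerA.
Qed.

Fact PGL_mulA : associative PGL_mul.
Proof.
move=> g h k; rewrite -(PGL_ofK g) -(PGL_ofK h) -(PGL_ofK k) !PGL_mulE.
by rewrite mulgA.
Qed.

Fact PGL_mul1g : left_id PGL_one PGL_mul.
Proof. by move=> g; rewrite -(PGL_ofK g) PGL_mulE mul1g. Qed.

Fact PGL_mulg1 : right_id PGL_one PGL_mul.
Proof. by move=> g; rewrite -(PGL_ofK g) PGL_mulE mulg1. Qed.

Fact PGL_mulVg : left_inverse PGL_one PGL_inv PGL_mul.
Proof. by move=> g; rewrite -{2}(PGL_ofK g) PGL_mulE mulVg. Qed.

Fact PGL_mulgV : right_inverse PGL_one PGL_inv PGL_mul.
Proof. by move=> g; rewrite -{1}(PGL_ofK g) PGL_mulE mulgV. Qed.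

HB.instance Definition _ :=
  isGroup.Build PGL PGL_mulA PGL_mul1g PGL_mulg1 PGL_mulVg PGL_mulgV.

End ProjectiveLinear.

Section Projective.
Variables (K : fieldType) (n : nat).

(* Projective n-space is the set of 1-dimensional subspaces of K^(n+1); its
   lines are given by the 2-dimensional subspaces. *)
Definition proj_space : Type := {p : {vspace 'cV[K]_n.+1} | \dim p == 1}.
Definition proj_line : Type := {l : {vspace 'cV[K]_n.+1} | \dim l == 2}.

HB.instance Definition _ := SubChoice.on proj_space.
HB.instance Definition _ := SubChoice.on proj_line.

Local Open Scope classical_set_scope.

Definition line_points (l : proj_line) : set proj_space :=
  [set p : proj_space | (val p <= val l)%VS].

Lemma gl_act_subproof (M : GL K n.+1) (p : proj_space) :
  \dim (linfun (mulmx (val M)) @: val p)%VS == 1.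
Proof.
rewrite limg_dim_eq ?(eqP (valP p)) //.
apply/eqP; rewrite -subv0; apply/subvP => v /memv_capP[_].
rewrite memv_ker lfunE /= => /eqP Mv0.
by rewrite memv0 -[v]mul1mx -(mulVmx (GL_unit M)) -mulmxA Mv0 mulmx0.
Qed.

Definition gl_act (M : GL K n.+1) (p : proj_space) : proj_space :=
  Sub (linfun (mulmx (val M)) @: val p)%VS (gl_act_subproof M p).

Definition pgl_act (g : PGL K n.+1) : proj_space -> proj_space :=
  gl_act (repr g).

Implicit Types (M : GL K n.+1) (p : proj_space) (g h : PGL K n.+1).

Lemma mem_gl_act M p (v : 'cV[K]_n.+1) :
  v \in val p -> val M *m v \in val (gl_act M p).
Proof.
by move=> pv; have := memv_img (linfun (mulmx (val M))) pv; rewrite lfunE.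
Qed.

Lemma gl_actP M p (w : 'cV[K]_n.+1) :
  reflect (exists2 v, v \in val p & w = val M *m v) (w \in val (gl_act M p)).
Proof.
apply: (iffP idP) => [/memv_imgP[v pv ->]|[v pv ->]]; last exact: mem_gl_act.
by exists v; rewrite // lfunE.
Qed.

Lemma pgl_act_of (M : GL K n.+1) p : pgl_act (PGL_of M) p = gl_act M p.
Proof.
have [a Ea] := repr_PGL_of M; apply: val_inj; apply/esym/eqP.
rewrite eqEdim !(eqP (gl_act_subproof _ _)) leqnn andbT.
apply/subvP => w /gl_actP[v pv ->]; rewrite Ea -scalemxAl.
by rewrite rpredZ ?mem_gl_act.
Qed.

Lemma pgl_act1 p : pgl_act 1%g p = p.
Proof.
rewrite pgl_act_of; apply/val_inj/vspaceP => v; apply/gl_actP/idP.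
  by move=> [w pw ->]; rewrite mul1mx.
by exists v; rewrite ?mul1mx.
Qed.

Lemma pgl_actM g h p : pgl_act (g * h)%g p = pgl_act g (pgl_act h p).
Proof.
rewrite pgl_act_of; apply/val_inj/vspaceP => v; apply/gl_actP/gl_actP.
  move=> [w pw ->]; exists (val (repr h) *m w); first exact: mem_gl_act.
  by rewrite mulmxA.
by move=> [_ /gl_actP[w pw ->] ->]; exists w; rewrite // mulmxA.
Qed.

Definition Stab (S : set proj_space) : set (PGL K n.+1) :=
  [set g | pgl_act g @` S = S].

Definition zero_locus (F : {mpoly K[n.+1]}) : set proj_space :=
  [set p : proj_space | forall v : 'cV[K]_n.+1, v \in val p -> F.@[fun i => v i 0] = 0].

(* F has no singular point on its zero locus (Jacobian criterion). *)
Definition smooth_form (F : {mpoly K[n.+1]}) : Prop :=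
  forall p, zero_locus F p ->
  forall v : 'cV[K]_n.+1, v \in val p -> v != 0 ->
    exists i, (F^`M(i)).@[fun j => v j 0] != 0.

Definition smooth_hypersurface (d : nat) (S : set proj_space) : Prop :=
  exists F : {mpoly K[n.+1]},
    [/\ F != 0, F \is d.-homog, smooth_form F & S = zero_locus F].

Definition Eckardt_point (S : set proj_space) (p : proj_space) : Prop :=
  exists l1 l2 l3 : proj_line,
    [/\ [/\ l1 != l2, l1 != l3 & l2 != l3],
        [/\ line_points l1 `<=` S, line_points l2 `<=` S
          & line_points l3 `<=` S]
      & line_points l1 `&` line_points l2 `&` line_points l3 = [set p]].

End Projective.

Notation smooth_cubic_surface := (@smooth_hypersurface _ 3 3).

(* Main.v *)
Require Import Defs.
From mathcomp Require Import all_boot all_order all_algebra.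
From mathcomp Require Import classical_sets.
From mathcomp Require Import ring boolp separable.
From mathcomp Require Import ssrcomplements freeg mpoly.

(* Write f(v) = T(v, v, v) with T symmetric trilinear.  A point p of the surface
   is an Eckardt point iff T(p, x, x) vanishes on the tangent plane
   T(p, p, x) = 0: the tangent section is then a cone over a binary cubic,
   which has distinct roots by smoothness.  In that case T(p, x, x) is the
   product of T(p, p, x) and a linear form m, and x |-> x - m(x) p is an
   involution preserving f.

   Conversely a projectivity stabilizing the surface lifts to M with f o M = f,
   since f is determined up to a factor by its zeros.  Smoothness makes the set
   of eigenvalues of M stable under a |-> a^-2, so they are roots of unity of
   order dividing 360, and a nontrivial unipotent matrix cannot preserve f;
   hence M^360 = 1.  Some power N of M is non-scalar with N^q scalar for q = 2,
   3 or 5, and an Eckardt point is found in each eigenvalue pattern of N.  The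
   two least direct cases are the cyclic surface x3^3 + c(x0, x1, x2), where one
   needs a flex of the plane cubic c, and q = 5: the Clebsch surface. *)

Set Implicit Arguments.
Unset Strict Implicit.
Unset Printing Implicit Defensive.

Import GRing.Theory.

Local Open Scope ring_scope.

(** A singular point is a nonzero [v] with [T v v w = 0] for all [w], and most contradictions below
    consist in exhibiting one. Points with prescribed properties come only from roots of
    one-variable polynomials or binary forms; this is why flexes are found through an explicit
    polynomial and not as intersections of the cubic with its Hessian. Finiteness of the stabilizer
    is not known beforehand, so finite order is extracted from the invariance of [T] alone: first
    for the eigenvalues, then for the unipotent part. The patterns of eigenvalues are manageable
    because [T] vanishes on three eigenvectors unless their eigenvalues multiply to 1, which leaves
    very sparse cubics. *)

Lemma eq_lin1 (R : pzRingType) (k l r a b : R) :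
  l = r -> a - b = k * (l - r) -> a = b.
Proof. by move=> -> /eqP; rewrite subrr mulr0 subr_eq0 => /eqP. Qed.

(** Like [eq_lin1], this turns a deduction from equations into a polynomial identity for [ring],
    with explicit cofactors [k] and [k'] as certificate. *)
Lemma eq_lin2 (R : pzRingType) (k l r k' l' r' a b : R) :
  l = r -> l' = r' -> a - b = k * (l - r) + k' * (l' - r') -> a = b.
Proof. by move=> -> -> /eqP; rewrite !subrr !mulr0 addr0 subr_eq0 => /eqP. Qed.

(** * Roots of polynomials over an algebraically closed field *)

Section ClosedField.
Variable K : closedFieldType.

(** If [p] were nonzero, ['X * p + 1] would be nonconstant, and at a root of it the vanishing of [p]
    would give [1 = 0]. *)
Lemma poly_fun0 (p : {poly K}) : (forall s, p.[s] = 0) -> p = 0.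
Proof.
move=> p0; have [//|pn0] := eqVneq p 0.
have /closed_rootP [s] : size ('X * p + 1) != 1%N.
  by rewrite mulrC size_polyDl size_mulX // ?size_poly1 ?ltnS ?eqSS ?lt0n
    ?size_poly_eq0.
by rewrite rootE !hornerE p0 mulr0 add0r oner_eq0.
Qed.

Lemma binary_quadratic_root (a b c : K) :
  exists s t, (s != 0) || (t != 0) /\ a * s ^+ 2 + b * s * t + c * t ^+ 2 = 0.
Proof.
have [a0|an0] := eqVneq a 0.
  by exists 1, 0; rewrite oner_eq0 a0; split => //; ring.
have /closed_rootP [s] : size (Poly [:: c; b; a]) != 1%N by rewrite
  (@PolyK _ 0).
rewrite rootE horner_Poly /= => /eqP E.
by exists s, 1; rewrite oner_eq0 orbT; split => //; rewrite -E; ring.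
Qed.

Lemma binary_cubic_root (a b c d : K) :
  exists s t, (s != 0) || (t != 0) /\
    a * s ^+ 3 + b * s ^+ 2 * t + c * s * t ^+ 2 + d * t ^+ 3 = 0.
Proof.
have [a0|an0] := eqVneq a 0.
  by exists 1, 0; rewrite oner_eq0 a0; split => //; ring.
have /closed_rootP [s] : size (Poly [:: d; c; b; a]) != 1%N by rewrite
  (@PolyK _ 0).
rewrite rootE horner_Poly /= => /eqP E.
by exists s, 1; rewrite oner_eq0 orbT; split => //; rewrite -E; ring.
Qed.

Lemma closed_nth_root n (a : K) : (0 < n)%N -> exists x : K, x ^+ n = a.
Proof.
move=> n0; have /closed_rootP [s] : size ('X^n - a%:P) != 1%N.
  by rewrite size_XnsubC // eqSS -lt0n.
by rewrite rootE !hornerE subr_eq0 => /eqP; exists s.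
Qed.

End ClosedField.

(** * Symmetric trilinear forms *)

Section SymmetricTrilinear.
Variables (K : fieldType) (V : lmodType K) (T : V -> V -> V -> K).

Record symmetric_trilinear : Prop := SymmetricTrilinear {
  trilinear_lin : forall a x y u v, T (a *: x + y) u v = a * T x u v + T y u v;
  trilinear_swap12 : forall x y z, T x y z = T y x z;
  trilinear_swap23 : forall x y z, T x y z = T x z y }.

(** [T v v w] is a third of the derivative of the cubic at [v] along [w], so this is the Jacobian
    criterion; the case [w = v] puts [v] on the surface. *)
Definition nondegenerate : Prop :=
  forall v, (forall w, T v v w = 0) -> v = 0.

Definition eckardt_vector p : Prop :=
  [/\ p != 0, T p p p = 0 & forall x, T p p x = 0 -> T p x x = 0].

Hypothesis Tsym : symmetric_trilinear.

Lemma triC12 x y z : T x y z = T y x z. Proof. exact: trilinear_swap12. Qed.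
Lemma triC23 x y z : T x y z = T x z y. Proof. exact: trilinear_swap23. Qed.
Lemma triC13 x y z : T x y z = T z y x.
Proof. by rewrite triC12 triC23 triC12. Qed.

Lemma triDl x y u v : T (x + y) u v = T x u v + T y u v.
Proof. by have := trilinear_lin Tsym 1 x y u v; rewrite scale1r mul1r. Qed.
Lemma tri0l u v : T 0 u v = 0.
Proof. by apply: (@addrI _ (T 0 u v)); rewrite -triDl !addr0. Qed.
Lemma triZl a x u v : T (a *: x) u v = a * T x u v.
Proof. by have := trilinear_lin Tsym a x 0 u v; rewrite tri0l !addr0. Qed.
Lemma triDm x y u v : T u (x + y) v = T u x v + T u y v.
Proof. by rewrite triC12 triDl !(triC12 u). Qed.
Lemma triZm a x u v : T u (a *: x) v = a * T u x v.
Proof. by rewrite triC12 triZl (triC12 u). Qed.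
Lemma tri0m u v : T u 0 v = 0.
Proof. by rewrite triC12 tri0l. Qed.
Lemma triDr x y u v : T u v (x + y) = T u v x + T u v y.
Proof. by rewrite triC13 triDl !(triC13 u). Qed.
Lemma triZr a x u v : T u v (a *: x) = a * T u v x.
Proof. by rewrite triC13 triZl (triC13 u). Qed.
Lemma tri0r u v : T u v 0 = 0.
Proof. by rewrite triC13 tri0l. Qed.
Definition triE := (triDl, triDm, triDr, triZl, triZm, triZr, tri0l, tri0m,
  tri0r).

Lemma tri_sqrD x y z :
  T (x + y) (x + y) z = T x x z + 2 * T x y z + T y y z.
Proof. by rewrite !triE (triC12 y x); ring. Qed.

Lemma tri_cubeD x y :
  T (x + y) (x + y) (x + y) =
  T x x x + 3 * T x x y + 3 * T x y y + T y y y.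
Proof.
rewrite !triE (triC12 y x) (triC23 x y x) (triC12 y x y) (triC13 y y x); ring.
Qed.

Lemma horner_tri_cube x y s :
  (Poly [:: T x x x; 3 * T x x y; 3 * T x y y; T y y y]).[s] =
  T (x + s *: y) (x + s *: y) (x + s *: y).
Proof. by rewrite horner_Poly tri_cubeD !triE /=; ring. Qed.

Lemma tri_cubeZ a x : T (a *: x) (a *: x) (a *: x) = a ^+ 3 * T x x x.
Proof. by rewrite !triE; ring. Qed.

End SymmetricTrilinear.

(** * A cubic form is determined by its zeros *)

Section SameZeros.
Variable K : closedFieldType.
Hypothesis charK0 : [pchar K] =i pred0.

Lemma natr_neq0 n : n.+1%:R != 0 :> K.
Proof. by move/pcharf0P: charK0 => ->. Qed.

Lemma quadratic_fun0 (a b c : K) :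
  (forall t, a + b * t + c * t ^+ 2 = 0) -> [/\ a = 0, b = 0 & c = 0].
Proof.
move=> abc0; have p0 : Poly [:: a; b; c] = 0.
  by apply: poly_fun0 => s; apply: etrans (abc0 s); rewrite horner_Poly /=;
    ring.
have coef0 i : [:: a; b; c]`_i = 0 by rewrite -coef_Poly p0 coef0.
by split; [exact: (coef0 0%N)|exact: (coef0 1%N)|exact: (coef0 2%N)].
Qed.

Lemma depressed_cubic_roots (b c : K) : 4 * b ^+ 3 + c ^+ 2 != 0 ->
  exists r : seq K, [/\ uniq r, size r = 3%N &
    {in r, forall t, c + 3 * b * t + t ^+ 3 = 0}].
Proof.
move=> disc_neq0; pose P := Poly [:: c; 3 * b; 0; 1].
have Pseq : P = [:: c; 3 * b; 0; 1] :> seq K by rewrite (@PolyK _ 0) ?oner_eq0.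
have [r Pr] := closed_field_poly_normal P.
rewrite /lead_coef Pseq scale1r in Pr.
have sr : size r = 3%N.
  have : size P = 4%N by rewrite Pseq.
  by rewrite Pr size_prod_XsubC => -[].
have PE t : P.[t] = c + 3 * b * t + t ^+ 3 by rewrite horner_Poly /=; ring.
exists r; split=> // [|t]; last first.
  by rewrite -root_prod_XsubC -Pr rootE PE => /eqP.
case: r sr Pr => [|x [|y [|z []]]] //= _ Pr.
have E t : c + 3 * b * t + t ^+ 3 = (t - x) * ((t - y) * (t - z)).
  by rewrite -PE Pr !big_cons big_nil mulr1 !hornerE.
have [cE bE zE] : [/\ c + x * y * z = 0, 3 * b - (x * y + y * z + x * z) = 0
    & x + y + z = 0].
  by apply: quadratic_fun0 => t; apply: (eq_lin1 (k := 1) (E t)); ring.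
have {}zE : z = - x - y by apply: (eq_lin1 (k := 1) zE); ring.
have {}cE : c = - (x * y * z) by apply: (eq_lin1 (k := 1) cE); ring.
have {}bE : 3 * b = x * y + y * z + x * z by apply: (eq_lin1 (k := 1) bE); ring.
(* The discriminant as a squared Vandermonde product; the factor 27 makes [b] occur only as [3 * b],
   which is a symmetric function of the roots. *)
have dE : 27 * (4 * b ^+ 3 + c ^+ 2) = - ((x - y) * (y - z) * (z - x)) ^+ 2.
  apply: (@etrans _ _ (4 * (3 * b) ^+ 3 + 27 * c ^+ 2)); first by ring.
  by rewrite bE cE zE; ring.
move: disc_neq0; rewrite !inE.
rewrite -(mulrI_eq0 _ (mulfI (natr_neq0 26))) dE oppr_eq0 expf_eq0 /= !mulf_eq0.
by rewrite !subr_eq0 !negb_or (eq_sym z) andbT andbAC -!andbA.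
Qed.

Variables (V : lmodType K) (T : V -> V -> V -> K).
Hypotheses (Tsym : symmetric_trilinear T) (Tnd : nondegenerate T).
Local Notation tE := (triE Tsym).

Section UnitPoint.
Variable p : V.
Hypothesis p1 : T p p p = 1.

Let f_line x t : T p p x = 0 ->
  T (x + t *: p) (x + t *: p) (x + t *: p) = T x x x + 3 * T x x p * t + t ^+ 3.
Proof.
move=> x0; rewrite (tri_cubeD Tsym) !tE p1 (triC13 Tsym x p p) x0; ring.
Qed.

Let split_p z : exists2 y, T p p y = 0 & z = y + T p p z *: p.
Proof.
by exists (z - T p p z *: p); rewrite ?subrK // -scaleN1r !tE p1; ring.
Qed.

(* If the discriminant vanished on the whole polar plane of [p], the double
   root of a generic line through [p] would be a singular point. *)
Let disc_generic y : T p p y = 0 -> y != 0 ->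
  exists2 x, T p p x = 0 & 4 * T x x p ^+ 3 + T x x x ^+ 2 != 0.
Proof.
move=> y0 yn0; apply: contrapT => nex.
have disc0 x : T p p x = 0 -> 4 * T x x p ^+ 3 + T x x x ^+ 2 = 0.
  by move=> x0; apply/eqP; apply: contra_notT nex => ?; exists x.
have [[x x0 xp]|nb] := pselect (exists2 x, T p p x = 0 & T x x p != 0).
  have d0 := disc0 x x0.
  have c_neq0 : T x x x != 0.
    apply: contraNneq xp => c0; move/eqP: d0; rewrite c0 expr0n addr0 mulf_eq0.
    by rewrite (negPf (natr_neq0 3)) expf_eq0.
  (* The double root of [t^3 + 3 b t + c] when [4 b^3 + c^2 = 0] and [b != 0] is [- c / (2 b)]. *)
  pose t := - T x x x / (2 * T x x p).
  have n2 := natr_neq0 1.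
  have sing : x + t *: p = 0.
    apply: Tnd => w; have [z z0 ->] := split_p w.
    rewrite (tri_sqrD Tsym) !tE p1 z0 (triC13 Tsym x p p) x0.
    (* One sixth of the derivative at [s = 0] of the discriminant along [x + s *: z], which vanishes
       identically. *)
    have E : 4 * T x x p ^+ 2 * T x z p + T x x x * T x x z = 0.
      have P0 : 4%:P * ((T x x p)%:P + (2 * T x z p)%:P * 'X + (T z z p)%:P *
        'X ^+ 2) ^+ 3
        + ((T x x x)%:P + (3 * T x x z)%:P * 'X + (3 * T x z z)%:P * 'X ^+ 2
            + (T z z z)%:P * 'X ^+ 3) ^+ 2 = 0.
        apply: poly_fun0 => s; rewrite
          !(hornerD, hornerM, horner_exp, hornerC, hornerX).
        rewrite -(disc0 (x + s *: z)); last by rewrite !tE x0 z0; ring.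
        rewrite (tri_cubeD Tsym) (tri_sqrD Tsym) !tE; ring.
      have := congr1 (fun P => P^`().[0]) P0.
      rewrite !derivE !hornerE /= => E.
      have n6 := natr_neq0 5.
      by apply: (mulfI n6); apply: (eq_lin1 (k := 1) E); ring.
    have {}E : T x x z = - (4 * T x x p ^+ 2 * T x z p) / T x x x.
      by apply: (mulfI c_neq0); rewrite mulrCA divff // mulr1;
        apply: (eq_lin1 (k := 1) E); ring.
    have cE : T x x x ^+ 2 = - (4 * T x x p ^+ 3) by apply:
      (eq_lin1 (k := 1) d0); ring.
    rewrite E (triC23 Tsym x p z) /t; field: cE.
    by rewrite n2 xp c_neq0.
  have t0 : t = 0.
    by have := congr1 (T p p) sing; rewrite !tE x0 p1 add0r mulr1.
  by move: sing xp; rewrite t0 scale0r addr0 => ->; rewrite !tE eqxx.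
(* In the remaining case the cubic is the cube of the linear form [T p p], and every point of the
   polar plane, such as [y], is singular. *)
have b0 x : T p p x = 0 -> T x x p = 0.
  by move=> x0; apply/eqP; apply: contra_notT nb => ?; exists x.
have c0 x : T p p x = 0 -> T x x x = 0.
  move=> x0; have /eqP := disc0 x x0; rewrite b0 // expr0n mulr0 add0r.
  by rewrite expf_eq0 => /eqP.
case/eqP: yn0; apply: Tnd => w; have [z z0 ->] := split_p w.
rewrite !tE b0 // mulr0 addr0.
have [_ E _] : [/\ T y y y = 0, 3 * T y y z = 0 & 3 * T y z z = 0].
  apply: quadratic_fun0 => s.
  have yz0 : T p p (y + s *: z) = 0 by rewrite !tE y0 z0; ring.
  have := c0 _ yz0; rewrite (tri_cubeD Tsym) !tE (c0 z) // => E.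
  by apply: (eq_lin1 (k := 1) E); ring.
by apply: (mulfI (natr_neq0 2)); rewrite E mulr0.
Qed.

(** On a line [x + t *: p] the form [D] has degree at most 2 in [t], because [D p p p = 0], yet it
    vanishes at the three distinct zeros of [T] when the discriminant is nonzero. This covers
    generic lines through [p]; the others follow by density along a pencil. *)
Lemma zeros_sub_eq0 (D : V -> V -> V -> K) : symmetric_trilinear D ->
  D p p p = 0 -> (forall v, T v v v = 0 -> D v v v = 0) ->
    forall v, D v v v = 0.
Proof.
move=> Dsym Dp sub v.
have line0 x : T p p x = 0 -> 4 * T x x p ^+ 3 + T x x x ^+ 2 != 0 ->
    forall t, D (x + t *: p) (x + t *: p) (x + t *: p) = 0.
  move=> x0 /depressed_cubic_roots [r [r_uniq sr rE]].
  pose Q := Poly [:: D x x x; 3 * D x x p; 3 * D x p p].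
  have QE t : Q.[t] = D (x + t *: p) (x + t *: p) (x + t *: p).
    by rewrite horner_Poly (tri_cubeD Dsym) !(triE Dsym) Dp /=; ring.
  move=> t; rewrite -QE; have [->|Qn0] := eqVneq Q 0; first by rewrite horner0.
  have : all (root Q) r.
    by apply/allP => s /rE E; rewrite rootE QE sub // f_line // E.
  move/(max_poly_roots Qn0)/(_ r_uniq); rewrite sr ltnNge.
  by rewrite (leq_trans (size_Poly _)).
have [y y0 ->] := split_p v; set t := T p p v.
have [->|yn0] := eqVneq y 0; first by rewrite add0r (tri_cubeZ Dsym) Dp mulr0.
have [x x0 xd] := disc_generic y0 yn0.
set z := y + t *: p.
pose P : {poly K} := 4%:P * ((T x x p)%:P + (2 * T x y p)%:P * 'X +
  (T y y p)%:P * 'X ^+ 2) ^+ 3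
        + ((T x x x)%:P + (3 * T x x y)%:P * 'X + (3 * T x y y)%:P * 'X ^+ 2
            + (T y y y)%:P * 'X ^+ 3) ^+ 2.
pose Q := Poly [:: D x x x; 3 * D x x z; 3 * D x z z; D z z z].
(* [P] is the discriminant at [x + s *: y] and [Q] is [D] at [x + s *: z], a point of the line
   joining [p] and [x + s *: y]. Since [P] is nonzero at 0, [Q] vanishes, and its coefficient of
   degree 3 is the wanted [D z z z]. *)
have PQ0 : P * Q = 0.
  apply: poly_fun0 => s; rewrite hornerM.
  pose xs := x + s *: y.
  have -> : P.[s] = 4 * T xs xs p ^+ 3 + T xs xs xs ^+ 2.
    by rewrite !(hornerD, hornerM, horner_exp, hornerC, hornerX)
      (tri_cubeD Tsym) (tri_sqrD Tsym) !tE; ring.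
  have -> : Q.[s] = D (xs + (s * t) *: p) (xs + (s * t) *: p)
    (xs + (s * t) *: p).
    by rewrite (horner_tri_cube Dsym) /xs -addrA -scalerA -scalerDr.
  have [->|?] := eqVneq (4 * T xs xs p ^+ 3 + T xs xs xs ^+ 2) 0.
    by rewrite mul0r.
  by rewrite line0 ?mulr0 // !tE x0 y0; ring.
have /eqP Q0 : Q == 0.
  move/eqP: PQ0; rewrite mulf_eq0 => /orP[/eqP P0|//].
  case/eqP: xd; rewrite -[RHS](horner0 0) -P0
    !(hornerD, hornerM, horner_exp, hornerC, hornerX); ring.
by have := coef_Poly [:: D x x x; 3 * D x x z; 3 * D x z z; D z z z] 3;
  rewrite -/Q Q0 coef0.
Qed.

End UnitPoint.

Lemma proportional_of_zeros_sub (T' : V -> V -> V -> K) :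
  symmetric_trilinear T' -> (forall v, T v v v = 0 -> T' v v v = 0) ->
  exists c, forall v, T' v v v = c * T v v v.
Proof.
move=> T'sym sub.
have [[p pn0]|nex] := pselect (exists p, T p p p != 0); last first.
  have T0 v : T v v v = 0 by apply/eqP; apply: contra_notT nex => ?; exists v.
  by exists 0 => v; rewrite mul0r sub.
have [a aE] := @closed_nth_root K 3 (T p p p)^-1 isT.
pose q := a *: p; have q1 : T q q q = 1 by rewrite (tri_cubeZ Tsym) aE mulVf.
exists (T' q q q) => v.
pose D x y z := T' x y z - T' q q q * T x y z.
suff : D v v v = 0 by rewrite /D => /eqP; rewrite subr_eq0 => /eqP.
apply: (zeros_sub_eq0 q1) => [||w Tw]; rewrite /D.
- split=> *; rewrite ?(triE Tsym) ?(triE T'sym); first by ring.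
    by rewrite (triC12 Tsym) (triC12 T'sym).
  by rewrite (triC23 Tsym) (triC23 T'sym).
- by rewrite q1; ring.
- by rewrite Tw sub // mulr0 subrr.
Qed.

End SameZeros.

(** * Invariant matrices have finite order *)

(** Eigenvectors in [eigenvalueP] are rows, whereas matrices act on columns here. *)
Lemma char_poly_tr (R : comNzRingType) n (M : 'M[R]_n) :
  char_poly M^T = char_poly M.
Proof.
rewrite /char_poly -det_tr; congr (\det _).
by rewrite /char_poly_mx linearB /= tr_scalar_mx map_trmx trmxK.
Qed.

Lemma dvdp_prod_XsubC (K : fieldType) (P : {poly K}) (r : seq K) :
  {in r, forall z, root P z} -> \prod_(z <- r) ('X - z%:P) %| P ^+ size r.
Proof.
elim: r => [|z r IHr] rP; first by rewrite big_nil dvd1p.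
rewrite big_cons exprS; apply: dvdp_mul.
  by rewrite dvdp_XsubCl rP ?mem_head.
by apply: IHr => w wr; rewrite rP // inE wr orbT.
Qed.

Section Automorphism.
Variable K : closedFieldType.
Hypothesis charK0 : [pchar K] =i pred0.

Lemma tri_cube_inj (V : lmodType K) (T T' : V -> V -> V -> K) :
  symmetric_trilinear T -> symmetric_trilinear T' ->
  (forall v, T v v v = T' v v v) -> forall x y z, T x y z = T' x y z.
Proof.
move=> Tsym T'sym TT'.
have sqr x y : T x x y = T' x x y.
  apply: (mulfI (natr_neq0 charK0 2)); apply/eqP; rewrite -subr_eq0; apply/eqP.
  pose c := 3 * T x y y - 3 * T' x y y.
  have [] // := @quadratic_fun0 _ 0 (3 * T x x y - 3 * T' x x y) c.
  move=> t; have := TT' (x + t *: y).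
  rewrite (tri_cubeD Tsym) (tri_cubeD T'sym) !(triE Tsym) !(triE T'sym).
  by rewrite !TT' /c => E; apply: (eq_lin1 (k := 1) E); ring.
move=> x y z; apply: (mulfI (natr_neq0 charK0 1)).
have := sqr (x + y) z; rewrite (tri_sqrD Tsym) (tri_sqrD T'sym) !sqr => E.
by apply: (eq_lin1 (k := 1) E); ring.
Qed.

Variable n : nat.
Variable T : 'cV[K]_n.+1 -> 'cV[K]_n.+1 -> 'cV[K]_n.+1 -> K.
Hypotheses (Tsym : symmetric_trilinear T) (Tnd : nondegenerate T).
Local Notation tE := (triE Tsym).

Definition tri_invariant (M : 'M[K]_n.+1) : Prop :=
  forall x y z, T (M *m x) (M *m y) (M *m z) = T x y z.

Lemma tri_invariantX M i : tri_invariant M -> tri_invariant (M ^+ i).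
Proof.
move=> Minv; elim: i => [|i IHi] x y z; first by rewrite !mul1mx.
by rewrite exprS -!mulmxA Minv IHi.
Qed.

(* The operator [N' := U^-1 - 1] is adjoint to [N (x) 1 + 1 (x) N + N (x) N];
   taking its [k+1]-st power against [N^(k-1) x] kills all terms but one. *)
Lemma unipotent_invariant_eq1 (U : 'M[K]_n.+1) i :
  U \in unitmx -> tri_invariant U -> (U - 1) ^+ i = 0 -> U = 1.
Proof.
move=> Uunit Uinv; elim: i => [/eqP|i IHi nil]; first by rewrite expr0 oner_eq0.
case: i IHi nil => [_ /eqP|i IHi nil]; first by rewrite expr1 subr_eq0 => /eqP.
apply: IHi.
have [N NE] : exists N, N = U - 1 by exists (U - 1).
have [N' N'E] : exists N', N' = invmx U - 1 by exists (invmx U - 1).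
rewrite -NE in nil *; have UE : U = 1 + N by rewrite NE addrC subrK.
have Ux x : U *m x = x + N *m x by rewrite UE mulmxDl mul1mx.
have adj x y z : T x y (N' *m z) =
    T (N *m x) y z + T x (N *m y) z + T (N *m x) (N *m y) z.
  have := Uinv x y (invmx U *m z); rewrite mulmxA mulmxV // mul1mx !Ux.
  rewrite N'E mulmxBl mul1mx -scaleN1r !tE => E.
  by apply: (eq_lin1 (k := - 1) E); ring.
have N'nil : N' ^+ i.+2 = 0.
  have {}N'E : N' = - (invmx U * N).
    by rewrite N'E NE mulrBr mulr1 -[_ * U]/(_ *m U) mulVmx // opprB.
  have /exprMn_comm comm : GRing.comm (invmx U) N.
    rewrite /GRing.comm NE mulrBr mulrBl mulr1 mul1r.
    by rewrite -[_ * U]/(_ *m U) -[U * _]/(U *m _) mulVmx ?mulmxV.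
  by rewrite N'E exprNn comm nil !mulr0.
have NX j (y : 'cV_n.+1) : N *m (N ^+ j *m y) = N ^+ j.+1 *m y.
  by rewrite exprS; exact: mulmxA.
(* As [N] kills [N *m u], at most one of the [j.+1] applications of [N'] can move an [N] onto [u];
   the factor [j.+1] counts which one. *)
have adjX j u y z : N *m (N *m u) = 0 ->
    T u y (N' ^+ j.+1 *m z) = T u (N ^+ j.+1 *m y) z +
    j.+1%:R * (T (N *m u) (N ^+ j *m y) z + T (N *m u) (N ^+ j.+1 *m y) z).
  move=> NNu; elim: j z => [|j IHj] z.
    by rewrite !expr1 expr0 mul1mx adj; ring.
  by rewrite exprSr -mulmxA IHj !adj NNu !NX !tE -[j.+2%:R]natr1; ring.
have [//|/eqP Nn0] := eqVneq (N ^+ i.+1) 0.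
have [x xn0] : exists x : 'cV_n.+1, N ^+ i.+1 *m x != 0.
  apply: contrapT => nex; apply: Nn0; apply/matrixP => a b.
  have : N ^+ i.+1 *m delta_mx b 0 = 0 :> 'cV_n.+1.
    by apply/eqP; apply: contra_notT nex => ?; exists (delta_mx b 0).
  by rewrite -colE => /matrixP /(_ a 0); rewrite !mxE.
case/eqP: xn0; apply: Tnd => z.
have Nu : N *m (N *m (N ^+ i *m x)) = 0.
  by rewrite !NX nil mul0mx.
(* With [w = N ^+ i.+1 *m x], the nilpotency of [N] and [N'] leaves [i.+2 * T w w z = 0], so [w] is
   singular. *)
have := adjX i.+1 _ x z Nu.
rewrite N'nil nil !mul0mx !tE addr0 add0r => /esym/eqP.
rewrite mulf_eq0 (negPf (natr_neq0 charK0 _)) /= => /eqP.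
by rewrite NX.
Qed.

Definition tri_row u v : 'rV_n.+1 := \row_j T u v (delta_mx j 0).

Lemma tri_rowE u v w : (tri_row u v *m w) 0 0 = T u v w.
Proof.
rewrite mxE [in RHS](matrix_sum_delta w).
have Tsum s : T u v (\sum_(j <- s) \sum_(k < 1) w j k *: delta_mx j k) =
    \sum_(j <- s) w j 0 * T u v (delta_mx j 0).
  elim: s => [|j s IHs]; first by rewrite !big_nil !tE.
  by rewrite !big_cons big_ord1 !tE IHs.
by rewrite Tsum; apply: eq_bigr => j _; rewrite mxE mulrC.
Qed.

(** If [M v = a v], then [T v v (M w) = a^-2 T (M v) (M v) (M w) = a^-2 T v v w]. Thus the linear
    form [T v v], nonzero by nondegeneracy, is a left eigenvector for [a^-2]. *)
Lemma invariant_eigenvalue M (a : K) : tri_invariant M ->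
  root (char_poly M) a -> a != 0 /\ root (char_poly M) (a^-1 ^+ 2).
Proof.
move=> Minv; rewrite -{1}[M]trmxK char_poly_tr -eigenvalue_root_char.
move=> /eigenvalueP [u uE un0]; pose v := u^T.
have vE : M *m v = a *: v by rewrite -[M]trmxK -trmx_mul uE linearZ.
have vn0 : v != 0.
  by apply: contraNneq un0 => v0; rewrite -[u]trmxK -/v v0 trmx0.
have an0 : a != 0.
  apply: contraNneq vn0 => a0; apply/eqP; apply: Tnd => w.
  by rewrite -Minv vE a0 scale0r !tE.
split=> //; rewrite -eigenvalue_root_char.
pose r := tri_row v v; have rE w : (r *m w) 0 0 = T v v w by exact: tri_rowE.
apply/eigenvalueP; exists r; last first.
  apply: contraNneq vn0 => r0; apply/eqP; apply: Tnd => w.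
  by rewrite -rE r0 mul0mx mxE.
apply/rowP => j.
transitivity ((r *m (M *m (delta_mx j 0 : 'cV_n.+1))) 0 0).
  by rewrite mulmxA -colE [RHS]mxE.
rewrite rE !mxE exprVn; apply: (mulfI (expf_neq0 2 an0)).
rewrite mulVKf ?expf_neq0 // -[RHS]Minv vE !tE; ring.
Qed.

End Automorphism.

Section FiniteOrder.
Variable K : closedFieldType.
Hypothesis charK0 : [pchar K] =i pred0.
Variable T : 'cV[K]_4 -> 'cV[K]_4 -> 'cV[K]_4 -> K.
Hypotheses (Tsym : symmetric_trilinear T) (Tnd : nondegenerate T).

Lemma expf_eq_diff (a : K) i d :
  a != 0 -> a ^+ (i + d) = a ^+ i -> (d %| 360)%N -> a ^+ 360 = 1.
Proof.
move=> an0 /eqP; rewrite exprD -[X in _ == X]mulr1.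
rewrite (inj_eq (mulfI (expf_neq0 _ an0))) => /eqP ad1 /dvdnP [q ->].
by rewrite mulnC exprM ad1 expr1n.
Qed.

(* The at most four eigenvalues are stable under [a |-> a^-2], so that two of
   [a, a^-2, a^4, a^-8, a^16] coincide. *)
Lemma invariant_eigenvalue_order M (a : K) : tri_invariant T M ->
  root (char_poly M) a -> a ^+ 360 = 1.
Proof.
move=> Minv r0.
have next := invariant_eigenvalue Tsym Tnd Minv.
have [an0 r1] := next _ r0; have [_ r2] := next _ r1.
have [_ r3] := next _ r2; have [_ r4] := next _ r3.
(* The exponents -8, -2, 1, 4, 16 shifted by 16. Their differences 3, 6, 9, 12, 15, 18, 24 have
   least common multiple 360. *)
pose s := [:: 8; 14; 17; 20; 32]%N.
have rs : all (root (char_poly M)) [seq a ^+ i / a ^+ 16 | i <- s].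
  rewrite /=; set h := (a^-1 ^+ 2) in r1 r2 r3 r4.
  have -> : a ^+ 17 / a ^+ 16 = a by field.
  have -> : a ^+ 14 / a ^+ 16 = h by rewrite /h !(exprVn, invrK) -?exprM; field.
  have -> : a ^+ 20 / a ^+ 16 = h^-1 ^+ 2 by rewrite /h !(exprVn, invrK)
    -?exprM; field.
  have -> : a ^+ 8 / a ^+ 16 = (h^-1 ^+ 2)^-1 ^+ 2 by rewrite /h
    !(exprVn, invrK) -?exprM; field.
  have -> : a ^+ 32 / a ^+ 16 = ((h^-1 ^+ 2)^-1 ^+ 2)^-1 ^+ 2 by rewrite /h
    !(exprVn, invrK) -?exprM; field.
  by rewrite r0 r1 r2 r3 r4.
have cn0 : char_poly M != 0 by rewrite monic_neq0 // char_poly_monic.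
have : ~~ uniq [seq a ^+ i / a ^+ 16 | i <- s].
  apply/negP => us; have := max_poly_roots cn0 rs us.
  by rewrite size_char_poly.
have cancel i d : a ^+ i / a ^+ 16 = a ^+ (i + d) / a ^+ 16 ->
    (d %| 360)%N -> a ^+ 360 = 1.
  move=> /(divIf (expf_neq0 _ an0)) E; exact: expf_eq_diff an0 (esym E).
rewrite /= !inE !negb_and !negbK !orbF -!orbA.
do !(case/orP); move/eqP.
- by move/(@cancel 8 6); apply.
- by move/(@cancel 8 9); apply.
- by move/(@cancel 8 12); apply.
- by move/(@cancel 8 24); apply.
- by move/(@cancel 14 3); apply.
- by move/(@cancel 14 6); apply.
- by move/(@cancel 14 18); apply.
- by move/(@cancel 17 3); apply.
- by move/(@cancel 17 15); apply.
- by move/(@cancel 20 12); apply.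
Qed.

(** All eigenvalues are roots of ['X^360 - 1], so the characteristic polynomial divides its fourth
    power. By Cayley-Hamilton [M ^+ 360] is then unipotent, hence 1 by invariance. *)
Lemma invariant_expr360 M : M \in unitmx -> tri_invariant T M -> M ^+ 360 = 1.
Proof.
move=> Mu Minv; apply: (unipotent_invariant_eq1 charK0 Tsym Tnd (i := 4)).
- exact: unitrX.
- exact: tri_invariantX.
have [r cE] := closed_field_poly_normal (char_poly M).
rewrite (monicP (char_poly_monic M)) scale1r in cE.
have sr : size r = 4%N.
  by apply/eqP; rewrite -eqSS -(size_prod_XsubC r id) -cE size_char_poly.
have : \prod_(z <- r) ('X - z%:P) %| ('X^360 - 1 : {poly K}) ^+ size r.
  apply: dvdp_prod_XsubC => z zr; rewrite rootE !hornerE.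
  by rewrite (invariant_eigenvalue_order Minv) ?subrr // cE root_prod_XsubC.
rewrite sr -cE => /dvdpP [q E].
have <- : horner_mx M (('X^360 - 1) ^+ 4) = (M ^+ 360 - 1) ^+ 4.
  by rewrite rmorphXn rmorphB rmorph1 rmorphXn /= horner_mx_X.
by rewrite E rmorphM /= Cayley_Hamilton mulr0.
Qed.

End FiniteOrder.

(** * Flexes of plane cubics *)

Section Combinations.
Variables (K : fieldType) (V : lmodType K).

Definition comb3 (x y z : V) a b c : V := a *: x + b *: y + c *: z.

Lemma comb3D x y z a b c a' b' c' :
  comb3 x y z a b c + comb3 x y z a' b' c' =
  comb3 x y z (a + a') (b + b') (c + c').
Proof. by rewrite /comb3 !scalerDl addrACA; congr (_ + _); rewrite addrACA. Qed.

Lemma comb3Z x y z k a b c :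
  k *: comb3 x y z a b c = comb3 x y z (k * a) (k * b) (k * c).
Proof. by rewrite /comb3 !scalerDr !scalerA. Qed.

Lemma comb3_1 x y z : x = comb3 x y z 1 0 0.
Proof. by rewrite /comb3 !scale0r scale1r !addr0. Qed.

Definition spans3 (W : V -> Prop) x y z : Prop :=
  forall v, W v -> exists a b c, v = comb3 x y z a b c.

Lemma spans3_trans (W U : V -> Prop) x y z x' y' z' :
  spans3 W x y z -> spans3 U x' y' z' -> U x -> U y -> U z -> spans3 W x' y' z'.
Proof.
move=> Wsp Usp /Usp[a1 [a2 [a3 xE]]] /Usp[b1 [b2 [b3 yE]]]
  /Usp[c1 [c2 [c3 zE]]].
move=> v /Wsp [a [b [c ->]]]; rewrite /comb3 xE yE zE !comb3Z !comb3D.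
by do 3!eexists.
Qed.

End Combinations.

Section Flex.
Variable K : closedFieldType.
Hypothesis charK0 : [pchar K] =i pred0.
Variables (V : lmodType K) (T : V -> V -> V -> K).
Hypothesis Tsym : symmetric_trilinear T.
Local Notation tE := (triE Tsym).

Variable W : V -> Prop.
Hypotheses (WD : forall x y, W x -> W y -> W (x + y))
  (WZ : forall a x, W x -> W (a *: x)).
Hypothesis Wnd : forall v, W v -> (forall w, W w -> T v v w = 0) -> v = 0.

(** [W] will be a three-dimensional eigenspace, on which [T] restricts to a smooth plane cubic. The
    last condition says that the tangent line at [p] meets the curve there with multiplicity at
    least 3. *)
Definition flex p : Prop :=
  [/\ W p, p != 0, T p p p = 0 & forall x, W x -> T p p x = 0 -> T p x x = 0].

(* On [z P + X v + Y u] the cubic is [3 (X z^2 + z Y^2 + m X^3 + k1 X^2 Y +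
   k2 X Y^2)]; with [X = 1], [Y = s] and [w = 2 z + s^2] the curve is
   [w^2 = D s] for a quartic [D], and it has a flex at [(s, w)] if and only if
   [8 w^3 = 2 D D'' - D'^2]. *)
Lemma flex_normal_form P u v m :
  W P -> W u -> W v ->
  spans3 W P v u ->
  T P P P = 0 -> T P P u = 0 -> T P P v = 1 ->
  T P u u = 1 -> T P v u = 0 -> T P v v = 0 -> T u u u = 0 ->
  T v v v = 3 * m -> exists p, flex p.
Proof.
move=> WP Wu Wv Wspan PPP PPu PPv Puu Pvu Pvv uuu vvv.
pose k1 := T v v u; pose k2 := T v u u.
have tabE := (PPP, PPu, PPv, Puu, Pvu, Pvv, uuu, vvv).
pose Q s z := z *: P + (v + s *: u).
have WQ s z : W (Q s z) by rewrite /Q; do ?apply: WD; do ?apply: WZ.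
have PPQ s z : T P P (Q s z) = 1 by rewrite /Q !tE !tabE; ring.
have Qn0 s z : Q s z != 0.
  apply/eqP => Q0; have := PPQ s z; rewrite Q0 !tE => /eqP.
  by rewrite eq_sym oner_eq0.
have symE := (fun x => triC12 Tsym v P x, fun x => triC12 Tsym u P x,
  fun x => triC12 Tsym u v x, fun x => triC23 Tsym x v P,
  fun x => triC23 Tsym x u P, fun x => triC23 Tsym x u v).
have QQP s z : T (Q s z) (Q s z) P = 2 * z + s ^+ 2.
  by rewrite (triC13 Tsym) /Q !tE !symE !tabE; ring.
have QQu s z : T (Q s z) (Q s z) u = k1 + 2 * k2 * s + 2 * s * z.
  by rewrite /Q /k1 /k2 !tE !symE !tabE; ring.
have QQQ s z : T (Q s z) (Q s z) (Q s z) =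
    3 * (z ^+ 2 + z * s ^+ 2 + m + k1 * s + k2 * s ^+ 2).
  by rewrite /Q /k1 /k2 !tE !symE !tabE; ring.
have PQu s z : T P (Q s z) u = s by rewrite /Q !tE !tabE; ring.
have uQu s z : T (Q s z) u u = z + k2.
  by rewrite /Q /k2 !tE !tabE; ring.
have spanQ s z x : W x -> exists a b c, x = a *: P + b *: Q s z + c *: u.
  move=> /Wspan [a [b [c ->]]]; exists (a - b * z), b, (c - b * s).
  rewrite /comb3 /Q !scalerDr !scalerBl !scalerA -!addrA; congr (_ + _).
  by rewrite addKr; congr (_ + _); rewrite addrC subrK.
clearbody Q; pose d2 := - (4 * k2); pose d1 := - (4 * k1); pose d0 := - (4 * m).
pose D s := s ^+ 4 + d2 * s ^+ 2 + d1 * s + d0.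
pose D' s := 4 * s ^+ 3 + 2 * d2 * s + d1.
(* Along the curve an inflection is [z'' = 0]; as [z = (w - s^2) / 2], this means [w'' = 2], and
   [w^2 = D] gives [4 w^3 w'' = 2 D D'' - D'^2], which is [G]. *)
pose G s := 2 * D s * (12 * s ^+ 2 + 2 * d2) - D' s ^+ 2.
(* [G^2 - 64 D^3] has degree 9, or 8 if [d1 = 0], unless [D] is a square. *)
pose H := [:: 16 * d2 ^+ 2 * d0 ^+ 2 - 8 * d2 * d1 ^+ 2 * d0 + d1 ^+ 4
    - 64 * d0 ^+ 3; - (192 * d1 * d0 ^+ 2); - (240 * d1 ^+ 2 * d0);
  - (256 * d2 * d1 * d0 + 96 * d1 ^+ 3);
  384 * d0 ^+ 2 - 96 * d2 ^+ 2 * d0 - 216 * d2 * d1 ^+ 2;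
  384 * d1 * d0 - 192 * d2 ^+ 2 * d1;
  256 * d2 * d0 + 48 * d1 ^+ 2 - 64 * d2 ^+ 3; 0; 48 * (4 * d0 - d2 ^+ 2);
  64 * d1].
have HE s : (Poly H).[s] = G s ^+ 2 - 64 * D s ^+ 3.
  by rewrite horner_Poly /H /G /D /D' /=; ring.
have [s sH] : exists s, G s ^+ 2 - 64 * D s ^+ 3 = 0.
  have [H0|sizeH] := eqVneq (size (Poly H)) 1%N; last first.
    by have /closed_rootP [s] := sizeH; rewrite rootE HE => /eqP; exists s.
  have coef0 i : (0 < i)%N -> H`_i = 0.
    by move=> i0; rewrite -coef_Poly nth_default // H0.
  have n64 := natr_neq0 charK0 63; have n48 := natr_neq0 charK0 47.
  have n2 := natr_neq0 charK0 1.
  have /eqP := coef0 9%N isT; rewrite mulf_eq0 (negPf n64) => /eqP d1_0.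
  have /eqP := coef0 8%N isT; rewrite mulf_eq0 (negPf n48) => /eqP d02.
  (* Here [D = (s^2 + d2 / 2)^2], and a root of it is a zero of both [D] and [G]. *)
  have [s sE] := @closed_nth_root K 2 (- d2 / 2) isT.
  have {}sE : d2 = - (2 * s ^+ 2) by rewrite sE mulrC divfK ?opprK.
  exists s; rewrite /G /D' d1_0.
  have Ds : 4 * D s = 0.
    by rewrite /D d1_0; apply: (eq_lin1 (k := 1) d02); rewrite sE; ring.
  have {}Ds : D s = 0.
    by apply: (mulfI (natr_neq0 charK0 3)); rewrite Ds mulr0.
  by rewrite Ds sE; ring.
have n2 := natr_neq0 charK0 1; have n4 := natr_neq0 charK0 3.
have n16 := natr_neq0 charK0 15.
(* If [D s = 0], then [G s = 0] forces [D' s = 0], and the point with [w = 0] over this double root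
   of [D] is singular. *)
have [D0|Dn0] := eqVneq (D s) 0.
  have D'0 : D' s = 0.
    have : D' s ^+ 2 ^+ 2 = 0.
      by apply: (eq_lin1 (k := 1) sH); rewrite /G D0; ring.
    by rewrite -exprM => /eqP; rewrite expf_eq0 => /eqP.
  pose z := - s ^+ 2 / 2.
  have zE : 2 * z = - s ^+ 2 by rewrite mulrC divfK.
  have QP0 : T (Q s z) (Q s z) P = 0 by rewrite QQP zE addNr.
  have Qu0 : T (Q s z) (Q s z) u = 0.
    apply: (mulfI n4); apply: (eq_lin2 (k := -1) D'0 (k' := 4 * s) zE).
    by rewrite QQu /D' /d2 /d1; ring.
  have QQ0 : T (Q s z) (Q s z) (Q s z) = 0.
    apply: (mulfI n4); apply: (eq_lin2 (k := - 3) D0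
      (k' := 3 * (2 * z + s ^+ 2)) zE).
    by rewrite QQQ /D /d2 /d1 /d0; ring.
  case/eqP: (Qn0 s z); apply: Wnd => // x /(spanQ s z) [a [b [c ->]]].
  by rewrite !tE QP0 Qu0 QQ0; ring.
have [w0 w0E] := @closed_nth_root K 2 (D s) isT.
(* Squaring lost the sign in [G = 8 w^3]; it is restored by the choice of the square root [w] of
   [D s]. *)
have [w wE GE] : exists2 w, w ^+ 2 = D s & G s = 8 * w ^+ 3.
  have : (G s - 8 * w0 ^+ 3) * (G s + 8 * w0 ^+ 3) = 0.
    by rewrite -w0E in sH; apply: (eq_lin1 (k := 1) sH); ring.
  move=> /eqP; rewrite mulf_eq0 subr_eq0 addr_eq0 => /orP[] /eqP E.
    by exists w0.
  by exists (- w0); rewrite ?sqrrN // E; ring.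
have wn0 : w != 0 by apply: contraNneq Dn0 => w0'; rewrite -wE w0' expr0n.
have [z zE] : exists z, 2 * z = w - s ^+ 2.
  by exists ((w - s ^+ 2) / 2); rewrite mulrC divfK.
have QQQ0 : T (Q s z) (Q s z) (Q s z) = 0.
  apply: (mulfI n4).
  apply: (eq_lin2 (k := 3) wE (k' := 3 * (2 * z + w + s ^+ 2)) zE).
  by rewrite QQQ /D /d2 /d1 /d0; ring.
exists (Q s z); split=> // x /(spanQ s z) [a [b [c ->]]].
have QE : T (Q s z) (Q s z) u = (s * w - D' s / 4).
  apply: (mulfI n4); apply: (eq_lin1 (k := 4 * s) zE).
  by rewrite QQu /D' /d2 /d1; field.
rewrite !tE QQP QQQ0 zE subrK => E0.
(* The left side is [T Q x x] times [w^2] for [x = a *: P + u] with [a w = - T Q Q u], a tangent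
   direction at [Q]. *)
have B0 : T (Q s z) (Q s z) u ^+ 2 - 2 * s * w * T (Q s z) (Q s z) u +
    (z + k2) * w ^+ 2 = 0.
  apply: (mulfI n16).
  apply: (eq_lin2 (k := - 1) GE (k' := 8 * w ^+ 2) zE).
  by rewrite QE /G -wE /d2; field.
have sE := (fun x => triC12 Tsym (Q s z) P x, fun x => triC12 Tsym u P x,
  fun x => triC12 Tsym u (Q s z) x, fun x => triC23 Tsym x (Q s z) P,
  fun x => triC23 Tsym x u P, fun x => triC23 Tsym x u (Q s z)).
rewrite !sE (triC13 Tsym P (Q s z) (Q s z)) QQP zE ?PPQ ?PQu ?uQu;
  apply: (mulfI (expf_neq0 2 wn0)).
set E := T (Q s z) (Q s z) u in B0 E0 *.
apply: (eq_lin2 (k := c ^+ 2) B0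
  (k' := a * w - c * E + 2 * b * w ^+ 2 + 2 * c * s * w) E0).
ring.
Qed.

(** Here [u] is tangent at [P] and [v] is not. If [T P u u = 0], then [P] itself is a flex.
    Otherwise the frame is normalized one coefficient at a time: scaling [u], adding a multiple of
    [P] to it, scaling [v], then subtracting from it a multiple of [u] and adding one of [P]. *)
Lemma flex_of_frame P u v :
  W P -> W u -> W v -> P != 0 -> spans3 W P v u ->
  T P P P = 0 -> T P P u = 0 -> T P P v != 0 -> exists p, flex p.
Proof.
move=> WP Wu Wv Pn0 Wspan PPP PPu PPv.
have [Puu|Puu] := eqVneq (T P u u) 0.
  exists P; split=> // x /Wspan [a [b [c ->]]].
  rewrite /comb3 !tE PPP PPu Puu !mulr0 add0r addr0 => /eqP.
  rewrite mulf_eq0 (negPf PPv) orbF => /eqP ->.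
  by rewrite !mul0r !mulr0 (triC23 Tsym P u P) PPu; ring.
have n3 := natr_neq0 charK0 2; have n2 := natr_neq0 charK0 1.
have [r rE] := @closed_nth_root K 2 (T P u u)^-1 isT.
have rn0 : r != 0.
  apply/eqP => r0; move: rE; rewrite r0 expr0n => /esym/eqP.
  by rewrite invr_eq0 (negPf Puu).
pose u1 := r *: u.
have PPu1 : T P P u1 = 0 by rewrite /u1 !tE PPu mulr0.
have Pu1u1 : T P u1 u1 = 1 by rewrite /u1 !tE mulrA -expr2 rE mulVf.
have Wu1 : W u1 by apply: WZ.
have uE : u = r^-1 *: u1 by rewrite /u1 scalerA mulVf // scale1r.
clearbody u1; pose k := - T u1 u1 u1 / 3; pose u2 := u1 + k *: P.
have Wu2 : W u2 by apply: WD => //; apply: WZ.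
have PPu2 : T P P u2 = 0 by rewrite /u2 (triDr Tsym) (triZr Tsym) PPu1 PPP;
  ring.
have u1E : u1 = u2 - k *: P by rewrite /u2 addrK.
have Pu2u2 : T P u2 u2 = 1.
  rewrite /u2 (triDr Tsym) (triDm Tsym) !(triZr Tsym) !(triZm Tsym).
  by rewrite (triDm Tsym) (triZm Tsym) (triC23 Tsym P u1 P) PPu1 PPP Pu1u1;
    ring.
have u2u2u2 : T u2 u2 u2 = 0.
  rewrite /u2 (tri_cubeD Tsym) !(triZr Tsym) !(triZm Tsym) !(triZl Tsym).
  rewrite (triC13 Tsym u1 u1 P) Pu1u1 (triC13 Tsym u1 P P) PPu1 PPP /k.
  by field.
clearbody u2; clearbody k.
pose v1 := (T P P v)^-1 *: v.
have PPv1 : T P P v1 = 1 by rewrite /v1 (triZr Tsym) mulVf.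
have Wv1 : W v1 by apply: WZ.
have vE : v = T P P v *: v1 by rewrite /v1 scalerA divff // scale1r.
clearbody v1; pose v2 := v1 - T P v1 u2 *: u2.
have PPv2 : T P P v2 = 1.
  by rewrite /v2 -scaleN1r !(triDr Tsym) !(triZr Tsym) PPu2 PPv1; ring.
have Pv2u2 : T P v2 u2 = 0.
  by rewrite /v2 -scaleN1r (triDm Tsym) !(triZm Tsym) Pu2u2; ring.
have Wv2 : W v2 by apply: WD => //; rewrite -scaleN1r; do !apply: WZ.
have v1E : v1 = v2 + T P v1 u2 *: u2 by rewrite /v2 subrK.
clearbody v2.
pose k' := - T P v2 v2 / 2; pose v3 := v2 + k' *: P.
have v2E : v2 = v3 - k' *: P by rewrite /v3 addrK.
have Wv3 : W v3 by apply: WD => //; apply: WZ.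
have PPv3 : T P P v3 = 1 by rewrite /v3 (triDr Tsym) (triZr Tsym) PPP PPv2;
  ring.
have Pv3u2 : T P v3 u2 = 0.
  by rewrite /v3 (triDm Tsym) (triZm Tsym) PPu2 Pv2u2; ring.
have Pv3v3 : T P v3 v3 = 0.
  rewrite /v3 !tE (triC23 Tsym P v2 P) PPP PPv2 /k'; field.
  exact: n2.
clearbody v3 k'.
apply: (@flex_normal_form P u2 v3 (T v3 v3 v3 / 3)) => //; last first.
  by rewrite mulrC divfK.
have sp : spans3 W P v3 u2.
  pose U x := exists a b c, x = comb3 P v3 u2 a b c.
  have UD x y : U x -> U y -> U (x + y).
    by move=> [a [b [c ->]]] [a' [b' [c' ->]]]; rewrite comb3D; do 3!eexists.
  have UZ a x : U x -> U (a *: x).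
    by move=> [a' [b' [c' ->]]]; rewrite comb3Z; do 3!eexists.
  have UP : U P by exists 1, 0, 0; exact: comb3_1.
  have Uv : U v3 by exists 0, 1, 0; rewrite /comb3 !scale0r scale1r addr0 add0r.
  have Uu : U u2 by exists 0, 0, 1; rewrite /comb3 !scale0r scale1r !add0r.
  apply: (spans3_trans Wspan (U := U)) => //.
    rewrite vE v1E v2E; apply: (UZ); apply: (UD); last exact: (UZ).
    by apply: (UD) => //; rewrite -scaleNr; apply: (UZ).
  by rewrite uE u1E; apply: (UZ); apply: (UD) => //; rewrite -scaleNr;
    apply: (UZ).
exact: sp.
Qed.

(** The curve has a point [P] on the line through [a] and [b]. Completing [P] to a spanning triple
    by exchange, one of the two other vectors is not tangent at [P], since [P] would be singular
    otherwise. *)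
Lemma exists_flex a b c : W a -> W b -> W c -> spans3 W a b c ->
  (forall s t, s *: a + t *: b = 0 -> s = 0 /\ t = 0) -> exists p, flex p.
Proof.
move=> Wa Wb Wc Wsp ab_free.
have [s [t [st0 E]]] := binary_cubic_root (T a a a) (3 * T a a b) (3 * T a b b)
  (T b b b).
pose P := s *: a + t *: b.
have WP : W P by apply: WD; apply: WZ.
have Pn0 : P != 0.
  by apply/eqP => /ab_free [s0 t0]; move: st0; rewrite s0 t0 eqxx.
have PPP : T P P P = 0.
  by apply: etrans E; rewrite /P (tri_cubeD Tsym) !tE; ring.
have [a' Wa' sp] : exists2 a', W a' & spans3 W P c a'.
  pose U d x := exists k l m, x = comb3 P c d k l m.
  have sP : s *: a = P - t *: b by rewrite /P addrK.
  have tP : t *: b = P - s *: a by rewrite /P addrC addKr.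
  clearbody P.
  have [s0|sn0] := eqVneq s 0.
    have tn0 : t != 0 by move: st0; rewrite s0 eqxx.
    exists a => //; apply: (spans3_trans Wsp (U := U a)) => //.
    - by exists 0, 0, 1; rewrite /comb3 !scale0r scale1r !add0r.
    - exists t^-1, 0, 0; rewrite /comb3 !scale0r !addr0.
      by rewrite -[b in LHS](scalerK tn0) tP s0 scale0r subr0.
    - by exists 0, 1, 0; rewrite /comb3 !scale0r scale1r addr0 add0r.
  exists b => //; apply: (spans3_trans Wsp (U := U b)) => //.
  - exists s^-1, 0, (- (s^-1 * t)); rewrite /comb3 scale0r addr0.
    by rewrite scaleNr -scalerA -scalerBr -sP scalerK.
  - by exists 0, 0, 1; rewrite /comb3 !scale0r scale1r !add0r.
  - by exists 0, 1, 0; rewrite /comb3 !scale0r scale1r addr0 add0r.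
clearbody P.
have [PPc|PPc] := eqVneq (T P P c) 0; last first.
  pose u := a' - (T P P a' / T P P c) *: c.
  have Wu : W u by apply: WD => //; rewrite -scaleNr; apply: WZ.
  apply: (@flex_of_frame P u c) => //; last first.
    rewrite /u -scaleNr !tE mulNr divfK // subrr //.
  apply: (spans3_trans sp (U := fun x => exists k l m, x = comb3 P c u k l m))
    => //.
  - by exists 1, 0, 0; exact: comb3_1.
  - by exists 0, 1, 0; rewrite /comb3 !scale0r scale1r addr0 add0r.
  - exists 0, (T P P a' / T P P c), 1; rewrite /comb3 scale0r scale1r add0r.
    by rewrite /u addrC subrK.
apply: (@flex_of_frame P c a') => //.
  move=> x /sp [k [l [m ->]]]; exists k, m, l; rewrite /comb3 -!addrA.
  by congr (_ + _); rewrite addrC.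
apply: contra_neq Pn0 => PPa'; apply: Wnd => // x /sp [k [l [m ->]]].
by rewrite /comb3 !tE PPP PPc PPa'; ring.
Qed.

End Flex.

(** * Eckardt vectors from an eigenbasis *)

Section Basis4.
Variables (K : fieldType) (V : lmodType K).

Definition comb2 (x y : V) a b : V := a *: x + b *: y.

Record basis4 (a b c d : V) : Prop := Basis4 {
  basis4_span : forall x, exists k l m n, x = comb2 a b k l + comb2 c d m n;
  basis4_free : forall k l m n, comb2 a b k l + comb2 c d m n = 0 ->
    [/\ k = 0, l = 0, m = 0 & n = 0] }.

End Basis4.

Section Cases.
Variable K : closedFieldType.
Hypothesis charK0 : [pchar K] =i pred0.
Variables (V : lmodType K) (T : V -> V -> V -> K).
Hypotheses (Tsym : symmetric_trilinear T) (Tnd : nondegenerate T).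
Local Notation tE := (triE Tsym).
Variable N : {linear V -> V}.
Hypothesis Ninv : forall x y z, T (N x) (N y) (N z) = T x y z.

Definition eigvec (l : K) x := N x = l *: x.

Lemma eigvecD l x y : eigvec l x -> eigvec l y -> eigvec l (x + y).
Proof. by rewrite /eigvec linearD scalerDr => -> ->. Qed.

Lemma eigvecZ l a x : eigvec l x -> eigvec l (a *: x).
Proof. by rewrite /eigvec linearZ /= => ->; rewrite !scalerA mulrC. Qed.

Lemma eigvec_comb2 l x y a b : eigvec l x -> eigvec l y ->
  eigvec l (comb2 x y a b).
Proof. by move=> lx ly; apply: eigvecD; apply: eigvecZ. Qed.

Lemma tri_eig0 l m n x y z : eigvec l x -> eigvec m y -> eigvec n z ->
  l * m * n != 1 -> T x y z = 0.
Proof.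
rewrite /eigvec => lx my nz lmn; have := Ninv x y z; rewrite lx my nz !tE => E.
have /eqP : (l * m * n - 1) * T x y z = 0 by apply: (eq_lin1 (k := 1) E); ring.
by rewrite mulf_eq0 subr_eq0 (negPf lmn) => /eqP.
Qed.

Lemma opp1_neq1 : -1 != 1 :> K.
Proof.
by rewrite eq_sym -addr_eq0 -[1 + 1]/(2%:R) (natr_neq0 charK0 1).
Qed.

(** In such names the digits list multiplicities of eigenvalues (first 1, then -1 for order 2) and
    the last number is the order of the eigenvalues. Here only even powers of the coordinate [n] of
    [d] survive in the cubic, whence [T d x x = 2 n T d d x]. *)
Lemma eckardt_of_31_2 a b c d : basis4 a b c d ->
  eigvec 1 a -> eigvec 1 b -> eigvec 1 c -> eigvec (-1) d ->
  eckardt_vector T d.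
Proof.
move=> [sp fr] ea eb ec ed.
have ddd : T d d d = 0.
  by apply: (tri_eig0 ed ed ed); rewrite mulrNN !mul1r opp1_neq1.
split=> // [|x].
  apply/eqP => d0; have [|_ _ _ /eqP] := fr 0 0 0 1; last by rewrite oner_eq0.
  by rewrite /comb2 d0 !scale0r scaler0 !addr0.
have [k [l [m [n ->]]]] := sp x.
have -> : comb2 a b k l + comb2 c d m n = (comb2 a b k l + m *: c) + n *: d.
  by rewrite /comb2 addrA.
set y := _ + m *: c.
have ey : eigvec 1 y by apply: eigvecD; [apply: eigvec_comb2|apply: eigvecZ].
have dyy : T d y y = 0 by apply: (tri_eig0 ed ey ey); rewrite !mulr1 opp1_neq1.
clearbody y; rewrite !tE ddd (triC23 Tsym d y d) => E.
have {E}ddy : T d d y = 0 by apply: etrans E; ring.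
by rewrite dyy ddy; ring.
Qed.

(** The cubic would be divisible by the coordinate of [d], hence singular where that plane meets the
    residual quadric. *)
Lemma no_13_2 a b c d : basis4 a b c d ->
  eigvec (-1) a -> eigvec (-1) b -> eigvec (-1) c -> eigvec 1 d -> False.
Proof.
move=> [sp fr] ea eb ec ed.
have [s [t [st0 E]]] := binary_quadratic_root (T a a d) (2 * T a b d) (T b b d).
pose v := comb2 a b s t.
have ev : eigvec (-1) v by apply: eigvec_comb2.
have vvd : T v v d = 0.
  by apply: etrans E; rewrite /v /comb2 !tE (triC12 Tsym b a); ring.
have v0 : v = 0.
  apply: Tnd => x; have [k [l [m [n ->]]]] := sp x.
  have -> : comb2 a b k l + comb2 c d m n = (comb2 a b k l + m *: c) + n *: d.
    by rewrite /comb2 addrA.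
  set y := _ + m *: c.
  have ey : eigvec (-1) y.
    by apply: eigvecD; [apply: eigvec_comb2|apply: eigvecZ].
  rewrite (triDr Tsym) (triZr Tsym) vvd mulr0 addr0.
  by apply: (tri_eig0 ev ev ey); rewrite mulrNN !mul1r opp1_neq1.
have [|s0 t0 _ _] := fr s t 0 0; last by move: st0; rewrite s0 t0 eqxx.
by rewrite -/v v0 /comb2 !scale0r !addr0.
Qed.

(** For [p] in the (-1)-eigenspace and [x = u + w], one has [T p p x = T p p u] and
    [T p x x = 2 T p u w]. The determinant of the bilinear form [T p u w] is quadratic in [p]; at a
    zero of it the form is a product [A(u) B(w)]. Since [T p p u = A(u) B(p)] is not identically 0,
    its vanishing forces [A(u) = 0]. *)
Lemma eckardt_of_22_2 a b c d : basis4 a b c d ->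
  eigvec 1 a -> eigvec 1 b -> eigvec (-1) c -> eigvec (-1) d ->
  exists p, eckardt_vector T p.
Proof.
move=> [sp fr] ea eb ec ed.
have [g [h [gh0 E]]] := binary_quadratic_root
  (T a c c * T b c d - T a c d * T b c c)
  (T a c c * T b d d - T a d d * T b c c)
    (T a c d * T b d d - T a d d * T b c d).
have [p pE] : exists p, p = comb2 c d g h by eexists.
have ep : eigvec (-1) p by rewrite pE; apply: eigvec_comb2.
have det0 : T p a c * T p b d - T p a d * T p b c = 0.
  apply: etrans E; rewrite pE /comb2 !tE !(triC12 Tsym c) !(triC12 Tsym d).
  by rewrite (triC23 Tsym a d c) (triC23 Tsym b d c); ring.
have pac : T p p a = g * T p a c + h * T p a d.
  by rewrite (triC23 Tsym) {2}pE /comb2 !tE.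
have pbc : T p p b = g * T p b c + h * T p b d.
  by rewrite (triC23 Tsym) {2}pE /comb2 !tE.
have opp1 : -1 * -1 * -1 != 1 :> K by rewrite mulrNN !mul1r opp1_neq1.
have pn0 : p != 0.
  apply/eqP => p0; have [|_ _ g0 h0] := fr 0 0 g h; last first.
    by move: gh0; rewrite g0 h0 eqxx.
  by rewrite -pE p0 /comb2 !scale0r !addr0.
have ppp : T p p p = 0 by apply: (tri_eig0 ep ep ep).
exists p; split=> // x; have [k [l [m [n ->]]]] := sp x.
set u := comb2 a b k l; set w := comb2 c d m n.
have eu : eigvec 1 u by apply: eigvec_comb2.
have ew : eigvec (-1) w by apply: eigvec_comb2.
have ppw : T p p w = 0 by apply: (tri_eig0 ep ep ew).
have pww : T p w w = 0 by apply: (tri_eig0 ep ew ew).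
have puu : T p u u = 0 by apply: (tri_eig0 ep eu eu); rewrite !mulr1 opp1_neq1.
rewrite (triDr Tsym) ppw addr0 => ppu.
rewrite (triC13 Tsym p) (tri_sqrD Tsym) !(triC13 Tsym _ _ p) puu pww addr0
  add0r.
rewrite (triC23 Tsym p w u).
(* [X] and [Y] are [T p u c] and [T p u d], so [A(u) = 0] amounts to [X = Y = 0]. *)
pose X := k * T p a c + l * T p b c; pose Y := k * T p a d + l * T p b d.
have {}ppu : g * X + h * Y = 0.
  by apply: etrans ppu; rewrite /u /comb2 !tE pac pbc /X /Y; ring.
have puw : T p u w = m * X + n * Y by rewrite /u /w /comb2 !tE /X /Y; ring.
rewrite puw.
have XB : X * T p a d = Y * T p a c.
  by apply: (eq_lin1 (k := - l) det0); rewrite /X /Y; ring.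
have XD : X * T p b d = Y * T p b c.
  by apply: (eq_lin1 (k := k) det0); rewrite /X /Y; ring.
have [X0 Y0] : X = 0 /\ Y = 0.
  have Xa : X * T p p a = 0.
    rewrite pac; apply: (eq_lin2 (k := T p a c) ppu (k' := h) XB); ring.
  have Xb : X * T p p b = 0.
    rewrite pbc; apply: (eq_lin2 (k := T p b c) ppu (k' := h) XD); ring.
  have Ya : Y * T p p a = 0.
    rewrite pac; apply: (eq_lin2 (k := T p a d) ppu (k' := - g) XB); ring.
  have Yb : Y * T p p b = 0.
    rewrite pbc; apply: (eq_lin2 (k := T p b d) ppu (k' := - g) XD); ring.
  have : T p p a != 0 \/ T p p b != 0.
    apply: contrapT => nab; case/eqP: pn0; apply: Tnd => y.
    have [ppa ppb] : T p p a = 0 /\ T p p b = 0.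
      by split; apply/eqP; apply: contra_notT nab => ?; [left|right].
    have [k' [l' [m' [n' ->]]]] := sp y.
    have ew' : eigvec (-1) (comb2 c d m' n') by apply: eigvec_comb2.
    by rewrite (triDr Tsym) (tri_eig0 ep ep ew') // /comb2 !tE ppa ppb; ring.
  move=> [] nz; split; apply/eqP;
    [move/eqP: Xa|move/eqP: Ya|move/eqP: Xb|move/eqP: Yb];
    by rewrite mulf_eq0 (negPf nz) orbF.
by rewrite X0 Y0; ring.
Qed.

(** Three cube roots of unity have product 1 only if all are equal or all are distinct, so terms
    mixing exactly two eigenspaces disappear in order 3. *)
Lemma cube_root_neq (l m : K) : l ^+ 3 = 1 -> l != m -> l * l * m != 1.
Proof.
move=> l1; apply: contraNneq => E; apply/eqP.
have ln0 : l != 0.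
  by apply: contraPneq E => ->; apply/eqP; rewrite !mul0r eq_sym oner_eq0.
by apply: (mulfI (mulf_neq0 ln0 ln0)); rewrite E -l1; ring.
Qed.

(** The cubic is a plane cubic on the [l]-eigenspace plus a multiple of the cube of the last
    coordinate. For a flex [p] of the former, [T p p d], [T p y d] and [T p d d] vanish, so that the
    flex condition extends to the whole space. *)
Lemma eckardt_of_31_3 a b c d l m : basis4 a b c d ->
  l ^+ 3 = 1 -> m ^+ 3 = 1 -> l != m ->
  eigvec l a -> eigvec l b -> eigvec l c -> eigvec m d ->
  exists p, eckardt_vector T p.
Proof.
move=> [sp fr] l1 m1 lm ea eb ec ed.
have dec x : exists2 y, eigvec l y & exists n, x = y + n *: d.
  have [k1 [k2 [k3 [k4 ->]]]] := sp x.
  exists (comb2 a b k1 k2 + k3 *: c); last by exists k4; rewrite /comb2 addrA.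
  by apply: eigvecD; [apply: eigvec_comb2|apply: eigvecZ].
have uud x y : eigvec l x -> eigvec l y -> T x y d = 0.
  by move=> ex ey; apply: (tri_eig0 ex ey ed); apply: cube_root_neq.
have [| | |||p [ep pn0 ppp pflex]] := @exists_flex _ charK0 _ _ Tsym (eigvec l)
  _ _ _ a b c ea eb ec.
- exact: eigvecD.
- exact: eigvecZ.
- move=> v ev vnd; apply: Tnd => x; have [y ey [n ->]] := dec x.
  by rewrite !tE uud // vnd //; ring.
- move=> x ex; have [k1 [k2 [k3 [k4 xE]]]] := sp x.
  have [k40|k4n0] := eqVneq k4 0.
    by exists k1, k2, k3; rewrite xE /comb2 k40 scale0r addr0.
  have ed' : eigvec l d.
    have : eigvec l (k4 *: d).
      have -> : k4 *: d = x + (-1) *: (comb2 a b k1 k2 + k3 *: c).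
        by rewrite xE scaleN1r /comb2 addrA [RHS]addrAC subrr add0r.
      apply: eigvecD => //; apply: eigvecZ; apply: eigvecD; last exact: eigvecZ.
      exact: eigvec_comb2.
    by move/(eigvecZ k4^-1); rewrite scalerK.
  have d0 : d = 0.
    apply/eqP; have := ed; rewrite /eigvec ed' => /eqP.
    by rewrite -subr_eq0 -scalerBl scaler_eq0 subr_eq0 (negPf lm).
  have [|_ _ _ /eqP] := fr 0 0 0 1; last by rewrite oner_eq0.
  by rewrite /comb2 d0 !scale0r scaler0 !addr0.
- move=> s t st; have [|-> -> _ _] := fr s t 0 0 => //.
  by rewrite /comb2 !scale0r !addr0.
exists p; split=> // x; have [y ey [n ->]] := dec x.
rewrite !tE uud // mulr0 addr0 => /(pflex _ ey) pyy.
rewrite pyy uud // (triC23 Tsym p d y) uud //.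
rewrite (tri_eig0 ep ed ed); first by ring.
by rewrite -mulrA mulrC cube_root_neq // eq_sym.
Qed.

(** The cubic is a sum of two binary cubics in separate variables. At a root [p] of the first,
    [T p p u = 0] forces [u] to be a multiple of [p], and the second does not enter [T p x x]. *)
Lemma eckardt_of_22_3 a b c d l m : basis4 a b c d ->
  l ^+ 3 = 1 -> m ^+ 3 = 1 -> l != m ->
  eigvec l a -> eigvec l b -> eigvec m c -> eigvec m d ->
  exists p, eckardt_vector T p.
Proof.
move=> [sp fr] l1 m1 lm ea eb ec ed.
have [s [t [st0 E]]] :=
  binary_cubic_root (T a a a) (3 * T a a b) (3 * T a b b) (T b b b).
have [p pE] : exists p, p = comb2 a b s t by eexists.
have ep : eigvec l p by rewrite pE; apply: eigvec_comb2.
have ppp : T p p p = 0.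
  by apply: etrans E; rewrite pE /comb2 (tri_cubeD Tsym) !tE; ring.
have pn0 : p != 0.
  apply/eqP => p0; have [|s0 t0 _ _] := fr s t 0 0; last first.
    by move: st0; rewrite s0 t0 eqxx.
  by rewrite -pE p0 /comb2 !scale0r !addr0.
have uuw x y z : eigvec l x -> eigvec l y -> eigvec m z -> T x y z = 0.
  by move=> ex ey ez; apply: (tri_eig0 ex ey ez); apply: cube_root_neq.
have uww x y z : eigvec l x -> eigvec m y -> eigvec m z -> T x y z = 0.
  move=> ex ey ez; apply: (tri_eig0 ex ey ez); rewrite -mulrA mulrC.
  by rewrite cube_root_neq // eq_sym.
exists p; split=> // x; have [k1 [k2 [k3 [k4 ->]]]] := sp x.
have eu := eigvec_comb2 k1 k2 ea eb; have ew := eigvec_comb2 k3 k4 ec ed.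
rewrite (triDr Tsym) (uuw p p _ ep ep ew) addr0 => ppu.
rewrite (triC13 Tsym p) (tri_sqrD Tsym) !(triC13 Tsym _ _ p)
  (uww p _ _ ep ew ew).
rewrite (triC23 Tsym p) (uuw p _ _ ep eu ew) mulr0 !addr0.
suff [k ->] : exists k, comb2 a b k1 k2 = k *: p by rewrite !tE ppp; ring.
have E0 : s * T p p a + t * T p p b = 0.
  by apply: etrans ppp; rewrite {7}pE /comb2 !tE.
have E1 : k1 * T p p a + k2 * T p p b = 0 by rewrite -[RHS]ppu /comb2 !tE.
have det0 : s * k2 - t * k1 = 0.
  apply/eqP/contraT => det0; case/eqP: pn0; apply: Tnd => y.
  have ppa : T p p a = 0.
    apply: (mulfI det0); apply: (eq_lin2 (k := k2) E0 (k' := - t) E1); ring.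
  have ppb : T p p b = 0.
    apply: (mulfI det0); apply: (eq_lin2 (k := - k1) E0 (k' := s) E1); ring.
  have [k1' [k2' [k3' [k4' ->]]]] := sp y.
  rewrite (triDr Tsym) (uuw p p _ ep ep (eigvec_comb2 k3' k4' ec ed)).
  by rewrite /comb2 !tE ppa ppb; ring.
rewrite pE /comb2; have [s0|sn0] := eqVneq s 0.
  have tn0 : t != 0 by move: st0; rewrite s0 eqxx.
  exists (k2 / t); rewrite scalerDr !scalerA divfK //; congr (_ *: _ + _).
  by apply: (mulfI tn0); apply: (eq_lin1 (k := -1) det0); rewrite s0; ring.
exists (k1 / s); rewrite scalerDr !scalerA divfK //; congr (_ + _ *: _).
apply: (mulfI sn0); apply: (eq_lin1 (k := 1) det0); field.
exact: sn0.
Qed.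

(** Besides pure cubes, only the term [T c d u] joins the eigenspaces. With [p = g *: c + d] on the
    surface, [T p x x] is visibly a multiple of the linear form [T p p x]. *)
Lemma eckardt_of_211_3 a b c d l m n : basis4 a b c d ->
  l ^+ 3 = 1 -> m ^+ 3 = 1 -> n ^+ 3 = 1 -> l != m -> l != n -> m != n ->
  eigvec l a -> eigvec l b -> eigvec m c -> eigvec n d ->
  exists p, eckardt_vector T p.
Proof.
move=> [sp fr] l1 m1 n1 lm ln mn ea eb ec ed.
have xxy i j x x' y : eigvec i x -> eigvec i x' -> eigvec j y -> i ^+ 3 = 1 ->
  i != j ->
    T x x' y = 0.
  by move=> ex ex' ey i1 ij; apply: (tri_eig0 ex ex' ey); apply: cube_root_neq.
have dec x : exists2 u, eigvec l u & exists g h, x = u + (g *: c + h *: d).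
  have [k1 [k2 [k3 [k4 ->]]]] := sp x.
  by exists (comb2 a b k1 k2); [apply: eigvec_comb2|exists k3, k4].
have ccd : T c c d = 0 by apply: (xxy m n).
have ddc : T d d c = 0 by apply: (xxy n m) => //; rewrite eq_sym.
have ccu u : eigvec l u -> T c c u = 0.
  by move=> eu; apply: (xxy m l) => //; rewrite eq_sym.
have ddu u : eigvec l u -> T d d u = 0.
  by move=> eu; apply: (xxy n l) => //; rewrite eq_sym.
have uuc u v : eigvec l u -> eigvec l v -> T u v c = 0.
  by move=> eu ev; apply: (xxy l m).
have uud u v : eigvec l u -> eigvec l v -> T u v d = 0.
  by move=> eu ev; apply: (xxy l n).
have cn0 : c != 0.
  apply/eqP => c0; have [|_ _ /eqP] := fr 0 0 1 0; last by rewrite oner_eq0.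
  by rewrite /comb2 c0 !scale0r scaler0 !addr0.
have dn0 : d != 0.
  apply/eqP => d0; have [|_ _ _ /eqP] := fr 0 0 0 1; last by rewrite oner_eq0.
  by rewrite /comb2 d0 !scale0r scaler0 !addr0.
have ccc : T c c c != 0.
  apply: contraNneq cn0 => ccc; apply/eqP/Tnd => x.
  by have [u eu [g [h ->]]] := dec x; rewrite !tE ccc ccd ccu //; ring.
have ddd : T d d d != 0.
  apply: contraNneq dn0 => ddd; apply/eqP/Tnd => x.
  by have [u eu [g [h ->]]] := dec x; rewrite !tE ddd ddc ddu //; ring.
have [g gE] := @closed_nth_root K 3 (- T d d d / T c c c) isT.
have {gE}dE : T d d d = - (g ^+ 3 * T c c c) by rewrite gE divfK // opprK.
have gn0 : g != 0.
  by apply: contraNneq ddd => g0; rewrite dE g0 expr0n mul0r oppr0.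
have [p pE] : exists p, p = g *: c + d by eexists.
have sE := (fun x => triC12 Tsym d c x, fun x => triC23 Tsym x d c).
have ppp : T p p p = 0.
  rewrite pE !tE !sE ccd (triC13 Tsym c d d) ddc dE; ring.
exists p; split=> // [|x].
  apply/eqP => p0; have [|_ _ g0 _] := fr 0 0 g 1; last first.
    by move: gn0; rewrite g0 eqxx.
  by rewrite /comb2 scale1r -pE p0 !scale0r !addr0.
have [u eu [g' [h ->]]] := dec x; set L := T c d u.
have {}sE := (sE, fun x => triC12 Tsym u c x, fun x => triC12 Tsym u d x,
  fun x => triC23 Tsym x u c, fun x => triC23 Tsym x u d).
have cdd : T c d d = 0 by rewrite (triC13 Tsym).
have cuu : T c u u = 0 by rewrite (triC13 Tsym) uuc.
have duu : T d u u = 0 by rewrite (triC13 Tsym) uud.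
have tabE := (ccd, cdd, cuu, duu, ccu u eu, ddu u eu, dE).
have ppx : T p p (u + (g' *: c + h *: d)) =
    g * (2 * L + g * T c c c * (g' - g * h)).
  by rewrite pE /L !tE !sE !tabE; ring.
have pxx : T p (u + (g' *: c + h *: d)) (u + (g' *: c + h *: d)) =
    (g * h + g') * (2 * L + g * T c c c * (g' - g * h)).
  by rewrite pE /L !tE !sE !tabE; ring.
rewrite ppx pxx => /eqP; rewrite mulf_eq0 (negPf gn0) => /eqP ->.
by rewrite mulr0.
Qed.

(** For [v] in the [l]-eigenspace the form [T v v] can be nonzero only on [c], and [T v v c] is a
    binary quadratic form in [v]; a zero of it is a singular point. *)
Lemma no_211_9 a b c d l : basis4 a b c d -> l ^+ 9 = 1 -> l ^+ 3 != 1 ->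
  eigvec l a -> eigvec l b -> eigvec (l ^- 2) c -> eigvec (l ^+ 4) d -> False.
Proof.
move=> [sp fr] l9 l3 ea eb ec ed.
have [s [t [st0 E]]] := binary_quadratic_root (T a a c) (2 * T a b c) (T b b c).
have [v vE] : exists v, v = comb2 a b s t by eexists.
have ev : eigvec l v by rewrite vE; apply: eigvec_comb2.
have vvc : T v v c = 0.
  by apply: etrans E; rewrite vE /comb2 !tE (triC12 Tsym b a); ring.
have v0 : v = 0.
  apply: Tnd => x; have [k1 [k2 [k3 [k4 ->]]]] := sp x.
  have vvu : T v v (comb2 a b k1 k2) = 0.
    apply: (tri_eig0 ev ev (eigvec_comb2 _ _ ea eb)).
    by rewrite -expr2 -exprSr.
  have vvd : T v v d = 0.
    apply: (tri_eig0 ev ev ed); rewrite -expr2 -exprD.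
    apply: contraNneq l3 => l6; apply/eqP.
    by rewrite -l9 -[9%N]/(6 + 3)%N exprD l6 mul1r.
  by rewrite (triDr Tsym) vvu /comb2 !tE vvc vvd; ring.
have [|s0 t0 _ _] := fr s t 0 0; last by move: st0; rewrite s0 t0 eqxx.
by rewrite -vE v0 /comb2 !scale0r !addr0.
Qed.

(* The Clebsch surface [sum y_j = sum y_j^3 = 0] in the eigenbasis of the
   cyclic shift, [y_j = sum_k z^(j k) x_k]; the vector found is the Eckardt
   point [y = (1, -1, 0, 0, 0)]. *)
Lemma eckardt_clebsch (z : K) a b c d : basis4 a b c d ->
  z ^+ 4 = - (1 + z + z ^+ 2 + z ^+ 3) ->
  (forall k l m n, let x := comb2 a b k l + comb2 c d m n in
    T x x x = 3 * (k ^+ 2 * l + l ^+ 2 * m + m ^+ 2 * n + n ^+ 2 * k)) ->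
  exists p, eckardt_vector T p.
Proof.
move=> [sp fr] z4 fE.
have n5 := natr_neq0 charK0 4.
have z1 : z != 1.
  apply: contraNneq n5 => z1; apply/eqP; apply: (eq_lin1 (k := 1) z4).
  by rewrite z1; ring.
have z5 : z ^+ 5 = 1 by apply: (eq_lin1 (k := z - 1) z4); ring.
(* Inverse Fourier transform of [y], up to the factor 5: the coordinates are [1 - z^(-k)] for [k] =
   1, 3, 4, 2, the order of the basis. *)
pose p1 := 1 - z ^+ 4; pose p2 := 1 - z ^+ 2; pose p3 := 1 - z;
  pose p4 := 1 - z ^+ 3.
have [p pE] : exists p, p = comb2 a b p1 p2 + comb2 c d p3 p4 by eexists.
have sumE k l m n k' l' m' n' s :
    comb2 a b k l + comb2 c d m n + s *: (comb2 a b k' l' + comb2 c d m' n') =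
    comb2 a b (k + s * k') (l + s * l') + comb2 c d (m + s * m') (n + s * n').
  rewrite /comb2 !scalerDr !scalerA !scalerDl addrACA; congr (_ + _);
    by rewrite addrACA.
(* Only values [T x x x] are given; [3 * T x x y] is the coefficient of [s] in the cubic at
   [x + s *: y]. *)
have polE k l m n k' l' m' n' (x := comb2 a b k l + comb2 c d m n)
    (y := comb2 a b k' l' + comb2 c d m' n') :
    T x x y = k ^+ 2 * l' + 2 * k * k' * l + l ^+ 2 * m' + 2 * l * l' * m
      + m ^+ 2 * n' + 2 * m * m' * n + n ^+ 2 * k' + 2 * n * n' * k.
  have cube s := fE (k + s * k') (l + s * l') (m + s * m') (n + s * n').
  have E s := cube s; rewrite /= in E.
  have {}E s : T (x + s *: y) (x + s *: y) (x + s *: y) =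
    3 * ((k + s * k') ^+ 2 * (l + s * l') + (l + s * l') ^+ 2 * (m + s * m') +
      (m + s * m') ^+ 2 * (n + s * n') + (n + s * n') ^+ 2 * (k + s * k')).
    by rewrite /x /y sumE E.
  have Ex := fE k l m n; have Ey := fE k' l' m' n'.
  rewrite /= -/x -/y in Ex Ey; clearbody x y.
  apply: (mulfI (natr_neq0 charK0 2)).
  have [|_ F _] := @quadratic_fun0 _ 0 (3 * T x x y -
      3 * (k ^+ 2 * l' + 2 * k * k' * l + l ^+ 2 * m' + 2 * l * l' * m
      + m ^+ 2 * n' + 2 * m * m' * n + n ^+ 2 * k' + 2 * n * n' * k))
    (3 * T x y y -
      3 * (k' ^+ 2 * l + 2 * k' * k * l' + l' ^+ 2 * m + 2 * l' * l * m'
      + m' ^+ 2 * n + 2 * m' * m * n' + n' ^+ 2 * k + 2 * n' * n * k')).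
    move=> s; have := E s; rewrite (tri_cubeD Tsym) !tE Ex Ey => F.
    by apply: (eq_lin1 (k := 1) F); ring.
  by apply: (eq_lin1 (k := 1) F); ring.
(* The first two of the coordinates [y_j]. At [p] the tangent plane is [y0 + y1 = 0], and [T p x x]
   is proportional to [y0^2 - y1^2]. *)
pose y0 (k l m n : K) := k + l + m + n.
pose y1 k l m n := z * k + z ^+ 3 * l + z ^+ 4 * m + z ^+ 2 * n.
have ppx k l m n : T p p (comb2 a b k l + comb2 c d m n) =
    5 * (y0 k l m n + y1 k l m n).
  rewrite pE polE /p1 /p2 /p3 /p4 /y0 /y1.
  ring: z4.
have pxx k l m n (x := comb2 a b k l + comb2 c d m n) : T p x x =
    (y0 k l m n - y1 k l m n) * (y0 k l m n + y1 k l m n).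
  rewrite (triC13 Tsym) pE polE /p1 /p2 /p3 /p4 /y0 /y1.
  ring: z4.
exists p; split.
- apply/eqP => p0; have [|_ _ p30 _] := fr p1 p2 p3 p4; first by rewrite -pE.
  by move: z1; rewrite eq_sym -subr_eq0 -/p3 p30 eqxx.
- by rewrite {3}pE ppx /p1 /p2 /p3 /p4 /y0 /y1; ring: z4.
move=> x; have [k [l [m [n ->]]]] := sp x.
rewrite ppx pxx => /eqP; rewrite mulf_eq0 (negPf n5) => /eqP ->.
by rewrite mulr0.
Qed.

(** Exponents must add up to 0 modulo 5, which leaves the monomials of [T a a b], [T b b c],
    [T c c d] and [T a d d]. None of these is 0, since [a], [b], [c] or [d] would be singular, so a
    diagonal rescaling makes them all 1. *)
Lemma eckardt_of_order5 z a b c d : basis4 a b c d -> z ^+ 5 = 1 -> z != 1 ->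
  eigvec z a -> eigvec (z ^+ 3) b -> eigvec (z ^+ 4) c -> eigvec (z ^+ 2) d ->
  exists p, eckardt_vector T p.
Proof.
move=> [sp fr] z5 z1 ea eb ec ed.
have zn0 : z != 0.
  by apply: contraPneq z5 => ->; apply/eqP; rewrite expr0n eq_sym oner_eq0.
have zX n : z ^+ n = z ^+ (n %% 5).
  by rewrite {1}(divn_eq n 5) exprD mulnC exprM z5 expr1n mul1r.
have z2 : z ^+ 2 != 1.
  apply: contraNneq z1 => z2; apply/eqP.
  by rewrite -z5 -[5%N]/(2 * 2 + 1)%N exprD exprM z2 expr1n mul1r.
have z3 : z ^+ 3 != 1.
  apply: contraNneq z2 => z3; apply/eqP.
  by rewrite -z5 -[5%N]/(3 + 2)%N exprD z3 mul1r.
have z4 : z ^+ 4 != 1.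
  apply: contraNneq z1 => z4; apply/eqP.
  by rewrite -z5 -[5%N]/(4 + 1)%N exprD z4 mul1r.
have Xn1 n : (n %% 5 != 0)%N -> z ^+ n != 1.
  rewrite zX; have : (n %% 5 < 5)%N by rewrite ltn_mod.
  by case: (n %% 5)%N => [|[|[|[|[|]]]]].
have T0 i j k x y w : eigvec (z ^+ i) x -> eigvec (z ^+ j) y ->
    eigvec (z ^+ k) w -> ((i + j + k) %% 5 != 0)%N -> T x y w = 0.
  move=> ex ey ew ijk; apply: (tri_eig0 ex ey ew).
  by rewrite -!exprD Xn1.
rewrite -[z in eigvec z a]expr1 in ea.
have tabE := (T0 1 1 1 a a a ea ea ea isT, T0 1 1 4 a a c ea ea ec isT,
  T0 1 1 2 a a d ea ea ed isT, T0 1 3 3 a b b ea eb eb isT,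
  T0 1 3 4 a b c ea eb ec isT, T0 1 3 2 a b d ea eb ed isT,
  T0 1 4 4 a c c ea ec ec isT, T0 1 4 2 a c d ea ec ed isT,
  T0 3 3 3 b b b eb eb eb isT, T0 3 3 2 b b d eb eb ed isT,
  T0 3 4 4 b c c eb ec ec isT, T0 3 4 2 b c d eb ec ed isT,
  T0 3 2 2 b d d eb ed ed isT, T0 4 4 4 c c c ec ec ec isT,
  T0 4 2 2 c d d ec ed ed isT, T0 2 2 2 d d d ed ed ed isT)%N.
have sE := (fun x => triC12 Tsym b a x, fun x => triC12 Tsym c a x,
  fun x => triC12 Tsym d a x, fun x => triC12 Tsym c b x,
  fun x => triC12 Tsym d b x, fun x => triC12 Tsym d c x,
  fun x => triC23 Tsym x b a, fun x => triC23 Tsym x c a,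
  fun x => triC23 Tsym x d a, fun x => triC23 Tsym x c b,
  fun x => triC23 Tsym x d b, fun x => triC23 Tsym x d c).
have fE k l m n (x := comb2 a b k l + comb2 c d m n) :
    T x x x = 3 * (k ^+ 2 * l * T a a b + l ^+ 2 * m * T b b c +
      m ^+ 2 * n * T c c d + n ^+ 2 * k * T a d d).
  by rewrite /x /comb2 !tE !sE !tabE; ring.
have aab : T a a b != 0.
  apply/eqP => aab; have a0 : a = 0.
    apply: Tnd => x; have [k [l [m [n ->]]]] := sp x.
    by rewrite /comb2 !tE aab !tabE; ring.
  have [|/eqP] := fr 1 0 0 0; last by rewrite oner_eq0.
  by rewrite /comb2 a0 !scale0r scaler0 !addr0.
have bbc : T b b c != 0.
  apply/eqP => bbc; have b0 : b = 0.
    apply: Tnd => x; have [k [l [m [n ->]]]] := sp x.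
    by rewrite /comb2 !tE !sE bbc !tabE; ring.
  have [|_ /eqP] := fr 0 1 0 0; last by rewrite oner_eq0.
  by rewrite /comb2 b0 !scale0r scaler0 !addr0.
have ccd : T c c d != 0.
  apply/eqP => ccd; have c0 : c = 0.
    apply: Tnd => x; have [k [l [m [n ->]]]] := sp x.
    by rewrite /comb2 !tE !sE ccd !tabE; ring.
  have [|_ _ /eqP] := fr 0 0 1 0; last by rewrite oner_eq0.
  by rewrite /comb2 c0 !scale0r scaler0 !addr0.
have add : T a d d != 0.
  apply/eqP => add; have d0 : d = 0.
    apply: Tnd => x; have [k [l [m [n ->]]]] := sp x.
    by rewrite /comb2 !tE !sE add !tabE; ring.
  have [|_ _ _ /eqP] := fr 0 0 0 1; last by rewrite oner_eq0.
  by rewrite /comb2 d0 !scale0r scaler0 !addr0.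
(* Solving the first three normalizations for [r1], [r2], [r3] in terms of [r] turns the fourth into
   this equation for [r ^+ 15]. *)
have [r rE] := @closed_nth_root K 15
  (T b b c ^+ 4 * T a d d / (T a a b ^+ 8 * T c c d ^+ 2)) isT.
have rn0 : r != 0.
  have nz : T b b c ^+ 4 * T a d d / (T a a b ^+ 8 * T c c d ^+ 2) != 0.
    by apply: mulf_neq0; rewrite ?invr_eq0 mulf_neq0 ?expf_neq0.
  by apply: contraNneq nz => r0; rewrite -rE r0 expr0n.
pose r1 := (r ^+ 2 * T a a b)^-1; pose r2 := (r1 ^+ 2 * T b b c)^-1.
pose r3 := (r2 ^+ 2 * T c c d)^-1.
have r1n0 : r1 != 0 by rewrite invr_eq0 mulf_neq0 ?expf_neq0.
have r2n0 : r2 != 0 by rewrite invr_eq0 mulf_neq0 ?expf_neq0.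
have r3n0 : r3 != 0 by rewrite invr_eq0 mulf_neq0 ?expf_neq0.
have E1 : r ^+ 2 * r1 * T a a b = 1.
  by rewrite mulrAC mulfV // mulf_neq0 ?expf_neq0.
have E2 : r1 ^+ 2 * r2 * T b b c = 1.
  by rewrite mulrAC mulfV // mulf_neq0 ?expf_neq0.
have E3 : r2 ^+ 2 * r3 * T c c d = 1.
  by rewrite mulrAC mulfV // mulf_neq0 ?expf_neq0.
have E4 : r3 ^+ 2 * r * T a d d = 1.
  have -> : r3 ^+ 2 * r * T a d d =
      (T b b c ^+ 4 * T a d d / (T a a b ^+ 8 * T c c d ^+ 2)) / r ^+ 15.
    by rewrite /r3 /r2 /r1; field; rewrite ?aab ?bbc ?ccd ?rn0.
  by rewrite -rE divff // expf_neq0.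
clearbody r1 r2 r3.
apply: (@eckardt_clebsch z (r *: a) (r1 *: b) (r2 *: c) (r3 *: d)).
- split=> [x|k l m n].
    have [k [l [m [n ->]]]] := sp x;
      exists (k / r), (l / r1), (m / r2), (n / r3).
    by rewrite /comb2 !scalerA !divfK.
  rewrite /comb2 !scalerA => /fr [] /eqP + /eqP + /eqP + /eqP.
  rewrite !mulf_eq0 (negPf rn0) (negPf r1n0) (negPf r2n0) (negPf r3n0) !orbF.
  by do 4!move=> /eqP ->.
- have z1' : z - 1 != 0 by rewrite subr_eq0.
  by apply: (mulfI z1'); apply: (eq_lin1 (k := 1) z5); ring.
move=> k l m n x.
have -> : x = comb2 a b (k * r) (l * r1) + comb2 c d (m * r2) (n * r3).
  by rewrite /x /comb2 !scalerA.
rewrite fE.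
have -> : 3 * ((k * r) ^+ 2 * (l * r1) * T a a b +
    (l * r1) ^+ 2 * (m * r2) * T b b c + (m * r2) ^+ 2 * (n * r3) * T c c d +
    (n * r3) ^+ 2 * (k * r) * T a d d) =
  3 * (k ^+ 2 * l * (r ^+ 2 * r1 * T a a b) + l ^+ 2 * m *
    (r1 ^+ 2 * r2 * T b b c)
    + m ^+ 2 * n * (r2 ^+ 2 * r3 * T c c d) + n ^+ 2 * k *
      (r3 ^+ 2 * r * T a d d)).
  by ring.
by rewrite E1 E2 E3 E4 !mulr1.
Qed.

End Cases.

(** * Matrices of prime order *)

Lemma trmx_expr (R : comNzRingType) n (A : 'M[R]_n.+1) k : (A ^+ k)^T = A^T ^+
  k.
Proof.
elim: k => [|k IHk]; first by rewrite !expr0 trmx1.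
by rewrite exprS exprSr -IHk; exact: trmx_mul.
Qed.

(** In characteristic 0 and for [z != 0] the polynomial ['X^p - z] is separable, so [N] is
    diagonalizable. The transposes exchange row and column eigenvectors. *)
Lemma expr_scalar_eigenbasis (K : closedFieldType) n p (z : K) (N : 'M[K]_n.+1)
  :
  [pchar K] =i pred0 -> (0 < p)%N -> z != 0 -> N ^+ p = z%:M ->
  exists P : 'M[K]_n.+1, exists l : 'I_n.+1 -> K,
    [/\ P \in unitmx, forall i, N *m col i P = l i *: col i P &
        forall i, l i ^+ p = z].
Proof.
case: p => // p charK0 _ zn0 Np.
have [r rE] := closed_field_poly_normal ('X^(p.+1) - z%:P).
rewrite lead_coefXnsubC // scale1r in rE.
have r_uniq : uniq r.
  rewrite -separable_prod_XsubC -rE separable_poly.unlock derivB derivXn derivC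
    subr0 /=.
  apply/Bezout_coprimepP; exists (p.+1%:R%:P, - 'X); rewrite /=.
  have -> : (p.+1%:R)%:P * ('X^(p.+1) - z%:P) + (- 'X) * ('X^p *+ p.+1) =
      (- (p.+1%:R * z))%:P :> {poly K}.
    by rewrite exprS -mulr_natr polyCN polyCM polyCMn; ring.
  by rewrite polyC_eqp1 oppr_eq0 mulf_neq0 // natr_neq0.
have : diagonalizable N^T.
  apply/diagonalizableP; exists r => //; apply: mxminpoly_min.
  rewrite -rE rmorphB rmorphXn /= horner_mx_X horner_mx_C.
  by rewrite -trmx_expr Np tr_scalar_mx subrr.
case=> P Pu /diagonalizable_forPex [d /(simmxP Pu) PN].
have eigP i : N *m col i P^T = d 0 i *: col i P^T.
  have E : N *m P^T = P^T *m diag_mx d.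
    by rewrite -[N]trmxK -trmx_mul PN trmx_mul tr_diag_mx.
  have -> : N *m col i P^T = col i (N *m P^T) by rewrite !colE mulmxA.
  by rewrite E; apply/colP => j; rewrite mxE mul_mx_diag !mxE mulrC.
exists P^T, (fun i => d 0 i); rewrite unitmx_tr; split=> // i.
have Nk k : N ^+ k *m col i P^T = d 0 i ^+ k *: col i P^T.
  elim: k => [|k IHk]; first by rewrite !expr0 mul1mx scale1r.
  by rewrite exprS -mulmxA IHk -scalemxAr eigP scalerA -exprSr.
have /eqP := Nk p.+1; rewrite Np mul_scalar_mx -subr_eq0 -scalerBl scaler_eq0.
rewrite subr_eq0 => /orP[/eqP //|/eqP col0].
have := mulVmx (etrans (unitmx_tr P) Pu) => /(congr1 (fun A => col i A)).
rewrite colE -mulmxA -colE col0 mulmx0 => /colP/(_ i)/eqP.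
by rewrite !mxE eqxx eq_sym oner_eq0.
Qed.

Lemma basis4_col (K : fieldType) (P : 'M[K]_4) (i j k l : 'I_4) :
  P \in unitmx -> uniq [:: i; j; k; l] ->
  basis4 (col i P) (col j P) (col k P) (col l P).
Proof.
move=> Pu ijkl.
have perm : perm_eq (index_enum 'I_4) [:: i; j; k; l].
  apply: uniq_perm; rewrite ?index_enum_uniq // => x; rewrite mem_index_enum.
  apply/esym; have [||_ ->] := uniq_min_size (s2 := enum 'I_4) ijkl.
  - by move=> y _; rewrite mem_enum.
  - by rewrite size_enum_ord.
  - by rewrite mem_enum.
split=> [x|a b c d].
  pose y := invmx P *m x; exists (y i 0), (y j 0), (y k 0), (y l 0).
  have -> : x = P *m y by rewrite mulmxA mulmxV // mul1mx.
  clearbody y; apply/colP => r; rewrite mxE (perm_big _ perm) /=.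
  by rewrite !big_cons big_nil addr0 !mxE -!addrA; do !congr (_ + _);
    rewrite mulrC.
rewrite /comb2 !colE !scalemxAr -!mulmxDr => /(congr1 (mulmx (invmx P))).
rewrite mulmxA mulVmx // mul1mx mulmx0 => /colP E.
move: ijkl; rewrite /= !inE !negb_or -!andbA =>
  /and4P[ij ik il /and4P[jk jl kl _]].
move: (E i) (E j) (E k) (E l); rewrite !mxE !eqxx /=.
rewrite !(eq_sym j i) !(eq_sym k i) !(eq_sym l i) !(eq_sym k j) !(eq_sym l j).
rewrite !(eq_sym l k) (negPf ij) (negPf ik) (negPf il) (negPf jk) (negPf jl).
by rewrite (negPf kl) /= !mulr0 !mulr1 !(addr0, add0r).
Qed.

Section PrimeOrder.
Variable K : closedFieldType.
Hypothesis charK0 : [pchar K] =i pred0.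
Variable T : 'cV[K]_4 -> 'cV[K]_4 -> 'cV[K]_4 -> K.
Hypotheses (Tsym : symmetric_trilinear T) (Tnd : nondegenerate T).
Local Notation tE := (triE Tsym).

Variables (N P : 'M[K]_4) (l : 'I_4 -> K).
Hypotheses (Ninv : tri_invariant T N) (Pu : P \in unitmx).
Hypothesis NP : forall i, N *m col i P = l i *: col i P.
Hypothesis Nns : ~~ is_scalar_mx N.

Let e i := col i P.
Let Nlin : {linear 'cV[K]_4 -> 'cV[K]_4} := mulmx N.

Lemma eigvec_col i c : l i = c -> eigvec Nlin c (e i).
Proof. by move=> <-; exact: NP. Qed.

Lemma eigenvalue_nonconst c : ~ (forall i, l i = c).
Proof.
move=> lc; case/negP: Nns; apply/is_scalar_mxP; exists c.
suff E : N *m P = c%:M *m P by rewrite -[N](mulmxK Pu) E mulmxK.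
apply/matrixP => i j; have /colP/(_ i) := NP j.
by rewrite lc !colE !mulmxA -!colE mul_scalar_mx !mxE.
Qed.

(** Nondegeneracy gives some [j] with [T (e i) (e i) (e j) != 0], and invariance then forces
    [l i ^+ 2 * l j = 1]. *)
Lemma eigenvalue_next i : exists j, l j = (l i)^-1 ^+ 2.
Proof.
have ei0 : e i != 0.
  apply/eqP => ei0; have := congr1 (col i) (mulVmx Pu).
  rewrite colE -mulmxA -colE -/(e i) ei0 mulmx0 => /colP/(_ i)/eqP.
  by rewrite !mxE eqxx eq_sym oner_eq0.
apply: contrapT => nex; case/eqP: ei0; apply: Tnd => w.
have T0 j : T (e i) (e i) (e j) = 0.
  apply: (tri_eig0 Tsym Ninv (eigvec_col (erefl (l i))) (eigvec_col erefl)
    (eigvec_col (erefl (l j)))).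
  apply: contra_notN nex => /eqP E; exists j.
  have li0 : l i != 0.
    by apply: contraPneq E => ->; apply/eqP; rewrite !mul0r eq_sym oner_eq0.
  by rewrite exprVn -[l j](mulKf (mulf_neq0 li0 li0)) E mulr1 expr2.
have := @basis4_col _ P 0 1 2%:R 3%:R Pu isT.
case=> sp _; have [a [b [c [d ->]]]] := sp w.
by rewrite /comb2 !tE -/(e _) !T0; ring.
Qed.

Let perm_classes (s : seq 'I_4) : perm_eq s (enum 'I_4) ->
  uniq s /\ size s = 4%N.
Proof.
move=> ss; rewrite (perm_uniq ss) (perm_size ss) enum_uniq size_enum_ord //.
Qed.

Lemma eckardt_of_order2 : (forall i, l i ^+ 2 = 1) ->
  exists p, eckardt_vector T p.
Proof.
move=> l2.
have lE i : l i != 1 -> l i = -1.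
  by move=> li1; have /eqP := l2 i; rewrite sqrf_eq1 (negPf li1) => /eqP.
pose s := [seq i <- enum 'I_4 | l i == 1];
  pose t := [seq i <- enum 'I_4 | l i != 1].
have [st_uniq st4] : uniq (s ++ t) /\ size (s ++ t) = 4%N.
  by apply: perm_classes; rewrite perm_filterC.
have sP i : i \in s -> eigvec Nlin 1 (e i).
  by rewrite mem_filter => /andP[/eqP li _]; apply: eigvec_col.
have tP i : i \in t -> eigvec Nlin (-1) (e i).
  by rewrite mem_filter => /andP[/lE li _]; apply: eigvec_col.
have B := basis4_col Pu; rewrite -/(e _) in B.
have sM i : l i = 1 -> i \in s by move=> li;
  rewrite mem_filter li eqxx mem_enum.
have tM i : l i != 1 -> i \in t by move=> li; rewrite mem_filter li mem_enum.
clearbody s t.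
case: s st_uniq st4 sP sM => [|i1 [|i2 [|i3 [|i4 [|i5 s]]]]] /=.
- move=> _ _ _ sM; case: (@eigenvalue_nonconst (-1)) => i; apply: lE.
  by apply/eqP => /sM.
- case: t tP tM => [|j1 [|j2 [|j3 []]]] // tP _ u _ sP _.
  case: (no_13_2 charK0 Tsym Tnd Ninv (B j1 j2 j3 i1 _)).
  + by rewrite (uniq_catC [:: j1; j2; j3] [:: i1]).
  1-3: by apply: tP; rewrite !inE eqxx ?orbT.
  by apply: sP; rewrite mem_head.
- case: t tP tM => [|j1 [|j2 []]] // tP _ u _ sP _.
  apply: (eckardt_of_22_2 charK0 Tsym Tnd Ninv (B _ _ _ _ u)).
  1,2: by apply: sP; rewrite !inE eqxx ?orbT.
  1,2: by apply: tP; rewrite !inE eqxx ?orbT.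
- case: t tP tM => [|j1 []] // tP _ u _ sP _.
  exists (e j1); apply: (eckardt_of_31_2 charK0 Tsym Ninv (B _ _ _ _ u)).
  1-3: by apply: sP; rewrite !inE eqxx ?orbT.
  by apply: tP; rewrite mem_head.
- case: t tP tM => // _ tM _ _ _ _; case: (@eigenvalue_nonconst 1) => i.
  by apply/eqP; apply: contraT => /tM.
- by case: t {tP tM}.
Qed.

Lemma eckardt_of_order3 : (forall i, l i ^+ 3 = 1) ->
  exists p, eckardt_vector T p.
Proof.
move=> l3.
have n3 := natr_neq0 charK0 2.
have /closed_rootP [w] : size (Poly [:: 1; 1; 1 : K]) != 1%N.
  by rewrite (@PolyK _ 0) ?oner_eq0.
rewrite rootE horner_Poly /= => /eqP wE.
have w3 : w ^+ 3 = 1 by apply: (eq_lin1 (k := w - 1) wE); ring.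
have w1 : w != 1.
  by apply: contraNneq n3 => w1; apply/eqP; rewrite -wE w1; ring.
have w0 : w != 0.
  by apply: contraPneq w3 => ->; apply/eqP; rewrite expr0n eq_sym oner_eq0.
have w2w : w ^+ 2 != w.
  by rewrite expr2 -[X in _ != X]mulr1 (inj_eq (mulfI w0)).
have w21 : w ^+ 2 != 1.
  by apply: contraNneq w1 => w2; apply/eqP; rewrite -w3 exprSr w2 mul1r.
have w23 : (w ^+ 2) ^+ 3 = 1 by rewrite -exprM mulnC exprM w3 expr1n.
have lE i : l i != 1 -> l i != w -> l i = w ^+ 2.
  move=> li1 liw; apply/eqP; rewrite -subr_eq0.
  have /eqP : (l i - 1) * (l i - w) * (l i - w ^+ 2) = 0.
    apply: (eq_lin2 (k := 1) (l3 i) (k' := w * l i - l i ^+ 2 - (w - 1)) wE).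
    ring.
  by rewrite !mulf_eq0 !subr_eq0 (negPf li1) (negPf liw).
pose f c := [seq i <- enum 'I_4 | l i == c].
have fE c i : (i \in f c) = (l i == c) by rewrite mem_filter mem_enum andbT.
have fP c i : i \in f c -> eigvec Nlin c (e i).
  by rewrite fE => /eqP; apply: eigvec_col.
have fu c : uniq (f c) by rewrite filter_uniq // enum_uniq.
have f_perm : perm_eq (f 1 ++ f w ++ f (w ^+ 2)) (enum 'I_4).
  apply: uniq_perm; rewrite ?enum_uniq //.
    rewrite !cat_uniq !fu /=.
    apply/and3P; split=> //; apply/hasPn => i; rewrite ?mem_cat /= !fE.
      by case/orP=> /eqP ->; rewrite ?(negPf w1) ?(negPf w21).
    by move/eqP=> ->; rewrite (negPf w2w).
  move=> i; rewrite !mem_cat !fE mem_enum.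
  have [//|li1] := eqVneq (l i) 1; have [//|liw] := eqVneq (l i) w.
  by rewrite lE ?eqxx.
have fconst c : size (f c) <> 4%N.
  move=> fc; apply: (@eigenvalue_nonconst c) => i; apply/eqP.
  have /allP : all (fun i => l i == c) (enum 'I_4).
    by rewrite all_count -size_filter -/(f c) fc size_enum_ord.
  by apply; rewrite mem_enum.
(* The three cube roots of unity play symmetric roles, so the multiplicities may be taken in
   decreasing order: 3+1, 2+2 or 2+1+1, as 4 would make [N] scalar. *)
have main a b c : a ^+ 3 = 1 -> b ^+ 3 = 1 -> c ^+ 3 = 1 ->
    a != b -> a != c -> b != c ->
    perm_eq (f a ++ f b ++ f c) (enum 'I_4) ->
    (size (f c) <= size (f b))%N -> (size (f b) <= size (f a))%N ->
    exists p, eckardt_vector T p.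
  move=> a3 b3 c3 ab ac bc /perm_classes [].
  have := fconst a; have := @fP a; have := @fP b; have := @fP c.
  have B := basis4_col Pu; rewrite -/(e _) in B.
  case: (f a) => [|i1 [|i2 [|i3 [|i4 r]]]] /=.
  - by case: (f b) => [|j1 s] //; case: (f c).
  - by case: (f b) => [|j1 [|j2 s]] //; case: (f c) => [|k1 [|k2 t]].
  - case: (f b) => [|j1 [|j2 [|j3 s]]] //; case: (f c) => [|k1 [|k2 t]] //.
      move=> cP bP aP _ u _ _ _.
      apply: (eckardt_of_211_3 Tsym Tnd Ninv (B i1 i2 j1 k1 u) a3 b3 c3) => //.
      1,2: by apply: aP; rewrite !inE eqxx ?orbT.
      by apply: bP; rewrite mem_head.
      by apply: cP; rewrite mem_head.
    move=> _ bP aP _ u _ _ _.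
    apply: (eckardt_of_22_3 Tsym Tnd Ninv (B i1 i2 j1 j2 u) a3 b3 ab).
    1,2: by apply: aP; rewrite !inE eqxx ?orbT.
    1,2: by apply: bP; rewrite !inE eqxx ?orbT.
  - case: (f b) => [|j1 [|j2 s]] //; case: (f c) => // _ bP aP _ u _ _ _.
    apply: (eckardt_of_31_3 charK0 Tsym Tnd Ninv (B i1 i2 i3 j1 u) a3 b3 ab).
    1-3: by apply: aP; rewrite !inE eqxx ?orbT.
    by apply: bP; rewrite mem_head.
  - move=> _ _ _ na _ []; rewrite size_cat => /eqP.
    by rewrite addn_eq0 => /andP[/eqP r0 _]; rewrite r0 in na.
have w12 : 1 != w by rewrite eq_sym.
have w13 : 1 != w ^+ 2 by rewrite eq_sym.
have w32 : w != w ^+ 2 by rewrite eq_sym.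
have one3 : 1 ^+ 3 = 1 :> K by rewrite expr1n.
have perm a b c : perm_eq (f a ++ f b ++ f c) (f 1 ++ f w ++ f (w ^+ 2)) ->
    perm_eq (f a ++ f b ++ f c) (enum 'I_4).
  by move=> h; apply: perm_trans h f_perm.
have [x12|/ltnW x12] := leqP (size (f w)) (size (f 1));
  have [x13|/ltnW x13] := leqP (size (f (w ^+ 2))) (size (f 1));
  have [x23|/ltnW x23] := leqP (size (f (w ^+ 2))) (size (f w)).
- exact: (main 1 w (w ^+ 2)).
- by apply: (main 1 (w ^+ 2) w) => //; apply: perm;
  rewrite perm_cat2l perm_catC.
- exact: (main 1 w (w ^+ 2)).
- by apply: (main (w ^+ 2) 1 w) => //; apply: perm; rewrite perm_catC -catA.
- by apply: (main w 1 (w ^+ 2)) => //; apply: perm; rewrite perm_catCA.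
- by apply: (main w 1 (w ^+ 2)) => //; apply: perm; rewrite perm_catCA.
- by apply: (main w (w ^+ 2) 1) => //; apply: perm; rewrite catA perm_catC.
- apply: (main (w ^+ 2) w 1) => //; apply: perm.
  by rewrite catA perm_catC perm_cat2l perm_catC.
Qed.
Lemma neq_col i j : l i != l j -> i != j.
Proof. by apply: contraNneq => ->. Qed.

(* The eigenvalues are the cube roots of [z <> 1], so that their set is stable
   under multiplication by [z^-1]. *)
Lemma no_order9 z : z ^+ 3 = 1 -> z != 1 -> ~ (forall i, l i ^+ 3 = z).
Proof.
move=> z3 z1 lz; pose a := l 0.
have a3 : a ^+ 3 != 1 by rewrite lz.
have a9 : a ^+ 9 = 1 by rewrite -[9%N]/(3 * 3)%N exprM lz.
have a0 : a != 0.
  by apply: contraPneq a9 => ->; apply/eqP; rewrite expr0n eq_sym oner_eq0.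
have a2E : a^-1 ^+ 2 = a ^- 2 by rewrite exprVn.
have a4E : (a ^- 2)^-1 ^+ 2 = a ^+ 4 by rewrite invrK -exprM.
have [j1 lj1] := eigenvalue_next 0; rewrite -/a a2E in lj1.
have [j2 lj2] := eigenvalue_next j1; rewrite lj1 a4E in lj2.
have a27 : a ^- 2 = a ^+ 7.
  by apply: (mulfI (expf_neq0 2 a0)); rewrite divff ?expf_neq0 // -exprD.
have X k m : a ^+ (9 * k + m) = a ^+ m.
  by rewrite exprD exprM a9 expr1n mul1r.
have neq k m : a ^+ (k + m) = a ^+ k -> a ^+ m = 1.
  rewrite exprD -[RHS in _ = RHS]mulr1 => /(mulfI (expf_neq0 k a0)) //.
have a6 : a ^+ 6 != 1.
  apply: contraNneq a3 => a6; apply/eqP.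
  by rewrite -a9 -[9%N]/(6 + 3)%N exprD a6 mul1r.
have n1 : l 0 != l j1.
  by apply: contraNneq a6 => E; apply/eqP/(@neq 1%N);
    rewrite -a27 -lj1 -E expr1.
have n2 : l 0 != l j2.
  by apply: contraNneq a3 => E; apply/eqP/(@neq 1%N); rewrite -lj2 -E expr1.
have n12 : l j1 != l j2.
  apply: contraNneq a3 => E; apply/eqP/(@neq 4%N).
  by rewrite -lj2 -E lj1 a27.
(* [a], [a^-2] and [a^4] are all the cube roots of [z], so the fourth eigenvalue repeats one of
   them. As [a |-> a^-2] permutes them cyclically, [no_211_9] applies from the repeated one. *)
have [j3] : exists j3, j3 \notin [:: 0; j1; j2].
  apply: contrapT => nex.
  have : {subset enum 'I_4 <= [:: 0; j1; j2]}.
    by move=> i _; apply: contra_notT nex => ?; exists i.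
  by move/(uniq_leq_size (enum_uniq _)); rewrite size_enum_ord.
rewrite !inE !negb_or => /and3P[j30 j31 j32].
have lj3 : l j3 = a \/ l j3 = a ^- 2 \/ l j3 = a ^+ 4.
  have W : 1 + a ^+ 3 + a ^+ 6 = 0.
    apply/eqP; have /eqP : (a ^+ 3 - 1) * (1 + a ^+ 3 + a ^+ 6) = 0.
      by apply: (eq_lin1 (k := 1) a9); ring.
    by rewrite mulf_eq0 subr_eq0 (negPf a3).
  have : (l j3 - a) * (l j3 - a ^+ 7) * (l j3 - a ^+ 4) = 0.
    have E3 : l j3 ^+ 3 = a ^+ 3 by rewrite !lz.
    apply: (eq_lin2 (k := 1) E3 (k' := - a * l j3 ^+ 2 + a ^+ 5 * l j3
      - a ^+ 3 * (a ^+ 3 - 1)) W).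
    ring.
  move=> /eqP; rewrite !mulf_eq0 !subr_eq0 -a27 => /orP[/orP[]|] /eqP ->; auto.
have B := basis4_col Pu; rewrite -/(e _) in B.
have n0j1 := neq_col n1; have n0j2 := neq_col n2; have nj1j2 := neq_col n12.
have evec i c : l i = c -> eigvec Nlin c (e i) := @eigvec_col i c.
have i9 : (a ^- 2) ^+ 9 = 1.
  by rewrite a27 -exprM -[(7 * 9)%N]/(9 * 7)%N exprM a9 expr1n.
have i3 : (a ^- 2) ^+ 3 != 1.
  by rewrite a27 -exprM -[(7 * 3)%N]/(9 * 2 + 3)%N X.
have f9 : (a ^+ 4) ^+ 9 = 1 by rewrite -exprM -[(4 * 9)%N]/(9 * 4)%N exprM a9
  expr1n.
have f3 : (a ^+ 4) ^+ 3 != 1.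
  by rewrite -exprM -[(4 * 3)%N]/(9 * 1 + 3)%N X.
case: lj3 => [lj3|[lj3|lj3]].
- apply: (no_211_9 Tsym Tnd Ninv (B 0 j3 j1 j2 _) a9 a3); rewrite -/(e _).
  + by rewrite /= !inE !negb_or (eq_sym 0 j3) j30 n0j1 n0j2 j31 j32 nj1j2.
  1-4: exact: evec.
- apply: (no_211_9 Tsym Tnd Ninv (B j1 j3 j2 0 _) i9 i3); rewrite -/(e _).
  + rewrite /= !inE !negb_or (eq_sym j1 j3) j31 nj1j2 (eq_sym j1 0) n0j1 j32.
    by rewrite j30 (eq_sym j2 0) n0j2.
  1-2: exact: evec.
  + by apply: evec; rewrite lj2 -exprVn a4E.
  + apply: evec; rewrite -/a a27 -exprM -[(7 * 4)%N]/(9 * 3 + 1)%N X //.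
- apply: (no_211_9 Tsym Tnd Ninv (B j2 j3 0 j1 _) f9 f3); rewrite -/(e _).
  + rewrite /= !inE !negb_or (eq_sym j2 j3) j32 (eq_sym j2 0) n0j2.
    by rewrite (eq_sym j2 j1) nj1j2 j30 j31 n0j1.
  1-2: exact: evec.
  + apply: evec; rewrite -/a -exprM.
    apply: (mulfI (expf_neq0 8 a0)); rewrite divff ?expf_neq0 //.
    by rewrite -exprSr a9.
  + by apply: evec; rewrite lj1 a27 -exprM -[(4 * 4)%N]/(9 * 1 + 7)%N X.
Qed.

(** Iterating [a |-> a^-2] from an eigenvalue [z != 1] yields [z], [z^3], [z^4], [z^2], so each
    primitive fifth root of unity occurs exactly once. *)
Lemma eckardt_of_order5_matrix :
  (forall i, l i ^+ 5 = 1) -> exists p, eckardt_vector T p.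
Proof.
move=> l5; have [i li1] : exists i, l i != 1.
  apply: contrapT => nex; apply: (@eigenvalue_nonconst 1) => i.
  by apply/eqP; apply: contra_notT nex => ?; exists i.
pose z := l i; have z5 : z ^+ 5 = 1 by rewrite l5.
have z0 : z != 0.
  by apply: contraPneq z5 => ->; apply/eqP; rewrite expr0n eq_sym oner_eq0.
have X k m : z ^+ (5 * k + m) = z ^+ m.
  by rewrite exprD exprM z5 expr1n mul1r.
have V k m q : (2 * k + m = 5 * q)%N -> (z ^+ k)^-1 ^+ 2 = z ^+ m.
  move=> km; apply: (mulfI (expf_neq0 (2 * k) z0)).
  have km1 : z ^+ (2 * k + m) = 1 by rewrite km exprM z5 expr1n.
  by rewrite -exprD km1 exprVn -exprM mulnC divff ?expf_neq0.
have [j1 lj1] := eigenvalue_next i; rewrite -/z -[z]expr1 (V 1 3 1)%N // in lj1.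
have [j2 lj2] := eigenvalue_next j1; rewrite lj1 (V 3 4 2)%N // in lj2.
have [j3 lj3] := eigenvalue_next j2; rewrite lj2 (V 4 2 2)%N // in lj3.
have neq k m : z ^+ k = z ^+ (k + m) -> z ^+ m = 1.
  by rewrite exprD -[LHS]mulr1 => /(mulfI (expf_neq0 k z0)).
have z2 : z ^+ 2 != 1.
  apply: contraNneq li1 => z2; apply/eqP.
  by rewrite -z5 -[5%N]/(2 * 2 + 1)%N exprD exprM z2 expr1n mul1r.
have z3 : z ^+ 3 != 1.
  apply: contraNneq z2 => z3; apply/eqP.
  by rewrite -z5 -[5%N]/(3 + 2)%N exprD z3 mul1r.
have n1 : i != j1.
  by apply/neq_col; apply: contraNneq z2; rewrite lj1 => /(neq 1 2)%N ->.
have n2 : i != j2.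
  by apply/neq_col; apply: contraNneq z3; rewrite lj2 => /(neq 1 3)%N ->.
have n3 : i != j3.
  by apply/neq_col; apply: contraNneq li1; rewrite lj3 => /(neq 1 1)%N/eqP.
have n12 : j1 != j2.
  by apply/neq_col; apply: contraNneq li1; rewrite lj1 lj2 => /(neq 3 1)%N/eqP.
have n13 : j1 != j3.
  by apply/neq_col; apply: contraNneq li1;
    rewrite lj1 lj3 => /esym/(neq 2 1)%N/eqP.
have n23 : j2 != j3.
  by apply/neq_col; apply: contraNneq z2;
    rewrite lj2 lj3 => /esym/(neq 2 2)%N ->.
have u : uniq [:: i; j1; j2; j3].
  by rewrite /= !inE !negb_or n1 n2 n3 n12 n13 n23.
apply: (eckardt_of_order5 charK0 Tsym Tnd Ninv (basis4_col Pu u) z5 li1).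
- exact: eigvec_col.
- exact: eigvec_col.
- exact: eigvec_col.
- exact: eigvec_col.
Qed.

End PrimeOrder.

(** * Reduction to prime order modulo scalars *)

Section Scalar.
Variable K : closedFieldType.
Hypothesis charK0 : [pchar K] =i pred0.
Variable T : 'cV[K]_4 -> 'cV[K]_4 -> 'cV[K]_4 -> K.
Hypotheses (Tsym : symmetric_trilinear T) (Tnd : nondegenerate T).
Local Notation tE := (triE Tsym).

(** Raising to the factors one after another, consider the last power that is not yet scalar. *)
Lemma scalar_power_step (M : 'M[K]_4) (s : seq nat) :
  ~~ is_scalar_mx M -> is_scalar_mx (M ^+ (\prod_(q <- s) q)) ->
  exists i q, [/\ q \in s, ~~ is_scalar_mx (M ^+ i) & is_scalar_mx
    (M ^+ i ^+ q)].
Proof.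
elim: s M => [|q s IHs] M Mns; first by rewrite big_nil expr1 (negPf Mns).
rewrite big_cons exprM => Mqs.
have [Mq|Mq] := boolP (is_scalar_mx (M ^+ q)).
  by exists 1%N, q; rewrite mem_head expr1.
have [i [r [rs Mi Mir]]] := IHs _ Mq Mqs.
by exists (q * i)%N, r; rewrite inE rs orbT !exprM.
Qed.

Lemma invariant_scalar (z : K) : tri_invariant T z%:M -> z ^+ 3 = 1.
Proof.
move=> zinv; have [//|z3] := eqVneq (z ^+ 3) 1.
have T0 x y w : T x y w = 0.
  have := zinv x y w; rewrite !mul_scalar_mx !tE => E.
  have /eqP : (z ^+ 3 - 1) * T x y w = 0.
    by apply: (eq_lin1 (k := 1) E); ring.
  by rewrite mulf_eq0 subr_eq0 (negPf z3) => /eqP.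
have /colP/(_ 0) : delta_mx 0 0 = 0 :> 'cV[K]_4 by apply: Tnd => w.
by rewrite !mxE !eqxx => /eqP; rewrite oner_eq0.
Qed.

(** [N ^+ q] is a cube root of unity [z]. For [q] = 2 or 5 the matrix [z *: N], still invariant, has
    [q]-th power [z^3] or [z^6], that is 1. For [q = 3] such rescaling changes nothing, and [z != 1]
    must be excluded by [no_order9]. *)
Lemma eckardt_of_prime_order (N : 'M[K]_4) q :
  tri_invariant T N -> ~~ is_scalar_mx N -> is_scalar_mx (N ^+ q) ->
  q \in [:: 2; 3; 5]%N -> exists p, eckardt_vector T p.
Proof.
move=> Ninv Nns /is_scalar_mxP [z Nq] q235.
have z3 : z ^+ 3 = 1.
  by apply: invariant_scalar; rewrite -Nq; apply: tri_invariantX.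
have z0 : z != 0.
  by apply: contraPneq z3 => ->; apply/eqP; rewrite expr0n eq_sym oner_eq0.
have q0 : (0 < q)%N by move: q235; rewrite !inE => /or3P[] /eqP ->.
have [P [l [Pu NP lq]]] := expr_scalar_eigenbasis charK0 q0 z0 Nq.
have zNinv : tri_invariant T (z *: N).
  by move=> x y w; rewrite -!scalemxAl !tE Ninv; apply: etrans (mul1r _);
    rewrite -z3; ring.
have zNns : ~~ is_scalar_mx (z *: N).
  apply: contra Nns => /is_scalar_mxP [c E]; apply/is_scalar_mxP;
    exists (z^-1 * c).
  by rewrite -[N](scalerK z0) E scale_scalar_mx.
have zNP i : (z *: N) *m col i P = (z * l i) *: col i P.
  by rewrite -scalemxAl NP scalerA.
move: q235; rewrite !inE => /or3P[] /eqP qE; rewrite {}qE in lq.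
- apply: (eckardt_of_order2 charK0 Tsym Tnd zNinv Pu zNP zNns) => i.
  by rewrite exprMn lq -exprSr.
- have [z1|z1] := eqVneq z 1; last first.
    by case: (no_order9 Tsym Tnd Ninv Pu NP z3 z1 lq).
  apply: (eckardt_of_order3 charK0 Tsym Tnd Ninv Pu NP Nns) => i.
  by rewrite lq z1.
apply: (eckardt_of_order5_matrix charK0 Tsym Tnd zNinv Pu zNP zNns) => i.
by rewrite exprMn lq -exprSr -[6%N]/(3 * 2)%N exprM z3 expr1n.
Qed.

Lemma eckardt_of_invariant (M : 'M[K]_4) : M \in unitmx ->
  tri_invariant T M -> ~~ is_scalar_mx M -> exists p, eckardt_vector T p.
Proof.
move=> Mu Minv Mns.
have [||i [q [qs Mi Miq]]] := @scalar_power_step M [:: 2; 2; 2; 3; 3; 5]%N =>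
  //.
  rewrite !big_cons big_nil (invariant_expr360 charK0 Tsym Tnd Mu Minv).
  exact: scalar_mx_is_scalar.
apply: (eckardt_of_prime_order (tri_invariantX i Minv) Mi Miq).
by move: qs; rewrite !inE; do !case/orP; move=> ->; rewrite ?orbT.
Qed.

End Scalar.

(** * The polar form of a cubic polynomial *)

Section Euler.
Variables (R : comNzRingType) (n : nat).
Implicit Types (p : {mpoly R[n]}) (v : 'I_n -> R).

Lemma mderiv_dhomog d i p : p \is d.+1.-homog -> p^`M(i) \is d.-homog.
Proof.
move=> /dhomogP ph; rewrite (mpolyE p) (big_morph _ (mderivD i) (mderiv0 _ i))
  big_seq.
apply: rpred_sum => m /ph md; rewrite mderivZ mderivX; apply: rpredZ.
have [mi0|mi] := eqVneq (m i) 0%N; first by rewrite mi0 scale0r rpred0.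
apply: rpredZ; rewrite dhomogX; apply/eqP.
have : mdeg m = d.+1 := md.
by rewrite -{1}(@submK _ U_(i)%MM m) ?lep1mP // mdegD mdeg1 addn1 => -[].
Qed.

Lemma dhomog_euler d p v : p \is d.-homog ->
  \sum_i v i * p^`M(i).@[v] = d%:R * p.@[v].
Proof.
move=> /dhomogP ph.
have monE m : \sum_i v i * ('X_[m])^`M(i).@[v] = (mdeg m)%:R * ('X_[m]).@[v].
  rewrite mdegE natr_sum mulr_suml; apply: eq_bigr => i _.
  rewrite mderivX mevalZ; have [->|mi] := eqVneq (m i) 0%N; first by ring.
  have XE : 'X_[R, m] = 'X_[m - U_(i)] * 'X_i.
    by rewrite -mpolyXD submK ?lep1mP.
  by rewrite [in RHS]XE mevalM mevalXU; ring.
have dE i : p^`M(i).@[v] = \sum_(m <- msupp p) p@_m * ('X_[m])^`M(i).@[v].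
  rewrite {1}[p]mpolyE (big_morph _ (mderivD i) (mderiv0 _ i)).
  rewrite (big_morph _ (mevalD v) (meval0 v)); apply: eq_bigr => m _.
  by rewrite mderivZ mevalZ.
transitivity (\sum_(m <- msupp p) p@_m * \sum_i v i * ('X_[m])^`M(i).@[v]).
  under eq_bigr do rewrite dE mulr_sumr.
  rewrite exchange_big /=; apply: eq_bigr => m _; rewrite mulr_sumr.
  by apply: eq_bigr => i _; ring.
rewrite [in RHS](mpolyE p) (big_morph _ (mevalD v) (meval0 v)) mulr_sumr
  big_seq [RHS]big_seq.
by apply: eq_bigr => m /ph md; rewrite monE mevalZ md; ring.
Qed.

Lemma dhomog0_meval p v w : p \is 0.-homog -> p.@[v] = p.@[w].
Proof.
move=> /dhomogP ph; rewrite !mevalE big_seq [RHS]big_seq.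
apply: eq_bigr => m /ph /eqP; rewrite mdeg_eq0 => /eqP ->.
by congr (_ * _); apply: eq_bigr => i _; rewrite mnm0E !expr0.
Qed.

End Euler.

Section CubicForm.
Variables (K : closedFieldType) (n : nat).
Hypothesis charK0 : [pchar K] =i pred0.
Variable F : {mpoly K[n.+1]}.
Hypothesis Fhom : F \is 3.-homog.

Let A i j k := (F^`M(i)^`M(j)^`M(k)).@[fun=> 0].

(** Third derivatives of a cubic form are constants, so evaluation at 0 loses nothing; the factor
    1/6 makes the diagonal equal to [F]. *)
Definition polar_form (u v w : 'cV[K]_n.+1) : K :=
  6^-1 * \sum_i u i 0 * \sum_j v j 0 * \sum_k w k 0 * A i j k.

Lemma polar_form_sym : symmetric_trilinear polar_form.
Proof.
split=> [a x y u v|x y z|x y z]; rewrite /polar_form.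
- rewrite [a * _]mulrCA -mulrDr [a * _]mulr_sumr -big_split /=; congr (_ * _).
  by apply: eq_bigr => i _; rewrite !mxE; ring.
- congr (_ * _).
  under eq_bigr do rewrite mulr_sumr; under [RHS]eq_bigr do rewrite mulr_sumr.
  rewrite exchange_big /=; apply: eq_bigr => i _; apply: eq_bigr => j _.
  rewrite mulrCA; congr (_ * (_ * _)); apply: eq_bigr => k _.
  by rewrite /A [F^`M(_)^`M(_)]mderiv_comm.
congr (_ * _); apply: eq_bigr => i _; congr (_ * _).
under eq_bigr do rewrite mulr_sumr; under [RHS]eq_bigr do rewrite mulr_sumr.
rewrite exchange_big /=; apply: eq_bigr => j _; apply: eq_bigr => k _.
by rewrite mulrCA /A [X in X.@[_]]mderiv_comm.
Qed.

(** Euler's identity for the first derivatives, of degree 2, and then for the second ones, of degree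
    1. *)
Lemma deriv_sum (v : 'cV[K]_n.+1) i : 2 * (F^`M(i)).@[fun j => v j 0] =
  \sum_j v j 0 * \sum_k v k 0 * A i j k.
Proof.
have h1 := mderiv_dhomog i Fhom.
rewrite -(dhomog_euler _ h1); apply: eq_bigr => j _; congr (_ * _).
have h2 := mderiv_dhomog j h1.
rewrite -[LHS]mul1r -(dhomog_euler _ h2); apply: eq_bigr => k _; congr (_ * _).
exact: dhomog0_meval (mderiv_dhomog k h2).
Qed.

Lemma polar_form_deriv (v : 'cV[K]_n.+1) i :
  (F^`M(i)).@[fun j => v j 0] = 3 * polar_form v v (delta_mx i 0).
Proof.
rewrite (triC13 polar_form_sym) /polar_form (bigD1 i) //=.
rewrite [X in _ + X]big1 => [|j ji]; last by rewrite mxE (negPf ji) mul0r.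
rewrite addr0 mxE !eqxx mul1r -deriv_sum.
have n6 := natr_neq0 charK0 5.
by field.
Qed.

Lemma polar_form_cube (v : 'cV[K]_n.+1) : F.@[fun i => v i 0] = polar_form v v
  v.
Proof.
have n6 := natr_neq0 charK0 5.
have -> : polar_form v v v = 6^-1 *
  (2 * \sum_i v i 0 * (F^`M(i)).@[fun j => v j 0]).
  congr (_ * _); rewrite mulr_sumr; apply: eq_bigr => i _.
  by rewrite -deriv_sum mulrCA.
by rewrite (dhomog_euler _ Fhom); field.
Qed.

Lemma smooth_nondegenerate : smooth_form F -> nondegenerate polar_form.
Proof.
move=> Fsm v vv; apply/eqP/contraT => vn0.
have dimv : \dim <[v]>%VS == 1%N by rewrite dim_vline vn0.
have [|i] := Fsm (exist _ <[v]>%VS dimv) _ v (memv_line v) vn0.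
  move=> u /vlineP [k ->]; rewrite polar_form_cube (tri_cubeZ polar_form_sym).
  by rewrite vv mulr0.
by rewrite polar_form_deriv vv mulr0 eqxx.
Qed.

End CubicForm.

(** * The tangent section at an Eckardt point *)

Lemma basis4P (K : fieldType) (a b c d : 'cV[K]_4) :
  free [:: a; b; c; d] <->
  (forall k l m n, comb2 a b k l + comb2 c d m n = 0 ->
    [/\ k = 0, l = 0, m = 0 & n = 0]).
Proof.
pose X := [tuple a; b; c; d].
have sumE (k : 'I_4 -> K) : \sum_(i < 4) k i *: X`_i =
    comb2 a b (k 0) (k 1) + comb2 c d (k 2%:R) (k 3%:R).
  rewrite !big_ord_recl big_ord0 addr0 /= /comb2 -!addrA.
  by do 4?congr (_ + _); congr (k _ *: _); apply: val_inj.
have -> : free [:: a; b; c; d] = free X by [].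
split=> [/freeP fX k l m n E|fr].
  have := fX (fun i => [:: k; l; m; n]`_i); rewrite sumE /= => /(_ E) k0.
  by split; [exact: (k0 0)|exact: (k0 1)|exact: (k0 2%:R)|exact: (k0 3%:R)].
apply/freeP => k; rewrite sumE => /fr [k0 k1 k2 k3] i.
case: i => [[|[|[|[|]]]] // lt]; [rewrite -[RHS]k0|rewrite -[RHS]k1|
  rewrite -[RHS]k2|rewrite -[RHS]k3]; by congr k; apply: val_inj.
Qed.

Lemma basis4_of_free (K : fieldType) (a b c d : 'cV[K]_4) :
  free [:: a; b; c; d] -> basis4 a b c d.
Proof.
move=> fr; split; last exact/basis4P.
move=> x; pose X := [tuple a; b; c; d].
have bX : basis_of fullv X.
  by rewrite basisEfree fr subvf dimvf /dim /= .
have := coord_basis bX (memvf x).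
rewrite !big_ord_recl big_ord0 addr0 /= => ->.
by do 4!eexists; rewrite /comb2 -!addrA.
Qed.

Lemma extend_basis4 (K : fieldType) (a b : 'cV[K]_4) :
  free [:: a; b] -> exists c d, basis4 a b c d.
Proof.
move=> fr; pose C := (<<[:: a; b]>>^C)%VS.
have dimC : \dim C = 2%N.
  by rewrite dimv_compl dimvf /dim /= (eqP fr).
have Cb := vbasisP C; have : free ([:: a; b] ++ vbasis C).
  rewrite cat_free fr (basis_free Cb) (span_basis Cb) /=.
  by apply/directv_addP; rewrite capv_compl.
have : size (vbasis C) = 2%N by rewrite size_tuple.
case: (vbasis C : seq _) => [|c [|d []]] //= _ /basis4_of_free B.
by exists c, d.
Qed.

Section EckardtVectorGeometry.
Variable K : closedFieldType.
Hypothesis charK0 : [pchar K] =i pred0.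
Variable T : 'cV[K]_4 -> 'cV[K]_4 -> 'cV[K]_4 -> K.
Hypotheses (Tsym : symmetric_trilinear T) (Tnd : nondegenerate T).
Local Notation tE := (triE Tsym).

Lemma exists_polar_neq0 p : p != 0 -> exists e, T p p e != 0.
Proof.
move=> pn0; apply: contrapT => nex; case/eqP: pn0; apply: Tnd => w.
by apply/eqP; apply: contra_notT nex => ?; exists w.
Qed.

Section Lines.
Variable p : 'cV[K]_4.
Hypothesis eck : eckardt_vector T p.

Let ppp : T p p p = 0. Proof. by case: eck. Qed.

Lemma eckardt_polar x y : T p p x = 0 -> T p p y = 0 -> T p x y = 0.
Proof.
case: eck => _ _ eckp x0 y0.
have xx := eckp x x0; have yy := eckp y y0.
have xy : T p p (x + y) = 0 by rewrite !tE x0 y0 addr0.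
have := eckp _ xy; rewrite !tE xx yy (triC23 Tsym p y x) add0r addr0 => E.
by apply: (mulfI (natr_neq0 charK0 1)); apply: (eq_lin1 (k := 1) E); ring.
Qed.

(* A double line of the tangent section at [p] would contain a singular point,
   found as a root of the quadratic below. *)
Lemma tangent_section_reduced e u v s t : basis4 p e u v ->
  T p p u = 0 -> T p p v = 0 -> T p p e != 0 -> let w := comb2 u v s t in
  T w w u = 0 -> T w w v = 0 -> w = 0.
Proof.
move=> [sp fr] ppu ppv ppe w wwu wwv.
have ppw : T p p w = 0 by rewrite /w /comb2 !tE ppu ppv !mulr0 addr0.
have pww := eckardt_polar ppw ppw; have pwu := eckardt_polar ppw ppu.
have pwv := eckardt_polar ppw ppv.
have [g [h [gh0 E]]] := binary_quadratic_root (T p p e) (2 * T p w e) (T w w e).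
have wE : w = comb2 u v s t by [].
clearbody w.
have [z zE] : exists z, z = g *: p + h *: w by eexists.
have z0 : z = 0.
  apply: Tnd => y; have [k [l [m [n ->]]]] := sp y.
  have zzp : T z z p = 0.
    rewrite zE !tE ppp (triC13 Tsym w w) pww (triC23 Tsym p w p) ppw.
    by rewrite (triC12 Tsym w p p) (triC23 Tsym p w p) ppw; ring.
  have zzu : T z z u = 0.
    by rewrite zE !tE ppu wwu (triC12 Tsym w p) pwu; ring.
  have zzv : T z z v = 0.
    by rewrite zE !tE ppv wwv (triC12 Tsym w p) pwv; ring.
  have zze : T z z e = 0.
    by apply: etrans E; rewrite zE !tE (triC12 Tsym w p); ring.
  by rewrite /comb2 !tE zzp zzu zzv zze; ring.
have [|g0 _ hs ht] := fr g 0 (h * s) (h * t).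
  rewrite -[RHS]z0 zE wE /comb2 scale0r addr0; congr (_ + _).
  by rewrite scalerDr !scalerA.
have hn0 : h != 0 by move: gh0; rewrite g0 eqxx.
have hw : h *: w = 0 by rewrite -z0 zE g0 scale0r add0r.
by rewrite -(scalerK hn0 w) hw scaler0.
Qed.

(** Restricted to the tangent plane, the cubic does not involve the coordinate along [p]: it is a
    binary cubic in the two other directions. One root is moved to [u], and the others solve a
    quadratic equation. *)
Lemma tangent_section_three_lines : exists e u v s1 s2,
  [/\ basis4 p e u v, s1 != s2, T p p e != 0 &
    forall w, w \in [:: u; s1 *: u + v; s2 *: u + v] ->
      forall a b, T (a *: p + b *: w) (a *: p + b *: w) (a *: p + b *: w) = 0].
Proof.
have pn0 : p != 0 by case: eck.
have n2 := natr_neq0 charK0 1; have n3 := natr_neq0 charK0 2.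
have [e ppe] := exists_polar_neq0 pn0.
have en0 : e != 0 by apply: contraNneq ppe => ->; rewrite (tri0r Tsym).
have pe_free : free [:: p; e].
  rewrite free_cons seq1_free en0 andbT span_seq1; apply/vlineP => -[k pE].
  have /eqP : k * T p p e = 0 by rewrite -(triZr Tsym) -pE.
  rewrite mulf_eq0 (negPf ppe) orbF => /eqP k0.
  by move: pn0; rewrite pE k0 scale0r eqxx.
have [u0 [v0 [sp0 fr0]]] := extend_basis4 pe_free.
pose proj x := x - (T p p x / T p p e) *: e.
have projP x : T p p (proj x) = 0.
  by rewrite /proj -scaleNr !tE mulNr divfK // subrr.
have projE x : x = proj x + (T p p x / T p p e) *: e by rewrite /proj subrK.
have [u1 [v1 [B1 ppu1 ppv1]]] : exists u1 v1,
    [/\ basis4 p e u1 v1, T p p u1 = 0 & T p p v1 = 0].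
  exists (proj u0), (proj v0); split=> //.
  set a := T p p u0 / T p p e in projE; set b := T p p v0 / T p p e.
  have combE k l m n : comb2 p e k l + comb2 (proj u0) (proj v0) m n =
      comb2 p e k (l - (m * a + n * b)) + comb2 u0 v0 m n.
    have -> : comb2 (proj u0) (proj v0) m n = comb2 u0 v0 m n - (m * a + n * b)
      *: e.
      by rewrite /comb2 /proj !scalerBr !scalerA addrACA -opprD -scalerDl.
    rewrite [comb2 p e k (_ - _)]/comb2 scalerBl [k *: p + (l *: e - _)]addrA.
    by rewrite addrA [RHS]addrAC.
  split=> [x|k l m n].
    have [k [l [m [n ->]]]] := sp0 x; exists k, (l + (m * a + n * b)), m, n.
    by rewrite combE; congr (comb2 _ _ _ _ + _); ring.
  rewrite combE => /fr0 [k0 E m0 n0]; split=> //.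
  by apply: (eq_lin1 (k := 1) E); rewrite m0 n0; ring.
have [s [t [st0 E]]] :=
  binary_cubic_root (T u1 u1 u1) (3 * T u1 u1 v1) (3 * T u1 v1 v1) (T v1 v1 v1).
pose u := comb2 u1 v1 s t.
have uuu : T u u u = 0.
  by apply: etrans E; rewrite /u /comb2 (tri_cubeD Tsym) !tE; ring.
have ppu : T p p u = 0 by rewrite /u /comb2 !tE ppu1 ppv1; ring.
have [v [B ppv]] : exists v, basis4 p e u v /\ T p p v = 0.
  case: B1 => sp1 fr1; rewrite /u.
  have [s0|sn0] := eqVneq s 0.
    have tn0 : t != 0 by move: st0; rewrite s0 eqxx.
    exists u1; split=> //; split=> [x|k l m n].
      have [k [l [m [n ->]]]] := sp1 x; exists k, l, (n / t), m.
      rewrite /comb2 s0 scale0r add0r scalerA divfK //; congr (_ + _).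
      by rewrite addrC.
    rewrite /comb2 s0 scale0r add0r scalerA [m * t *: v1 + _]addrC.
    move=> /fr1 [-> -> -> /eqP]; rewrite mulf_eq0 (negPf tn0) orbF.
    by move/eqP->.
  exists v1; split=> //; split=> [x|k l m n].
    have [k [l [m [n ->]]]] := sp1 x; exists k, l, (m / s), (n - m / s * t).
    rewrite /comb2; congr (_ + _); rewrite scalerDr !scalerA divfK // -addrA.
    by congr (_ + _); rewrite -scalerDl; congr (_ *: _); ring.
  have -> : comb2 (comb2 u1 v1 s t) v1 m n = comb2 u1 v1 (m * s) (m * t + n).
    by rewrite /comb2 scalerDr !scalerA -addrA -scalerDl.
  move=> /fr1 [-> -> /eqP]; rewrite mulf_eq0 (negPf sn0) orbF => /eqP ->.
  by rewrite mul0r add0r.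
clearbody u; have [sp fr] := B.
have un0 : u != 0.
  apply/eqP => u0'; have [|_ _ /eqP] := fr 0 0 1 0; last by rewrite oner_eq0.
  by rewrite /comb2 u0' !scale0r scaler0 !addr0.
have uuv : T u u v != 0.
  apply: contraNneq un0 => uuv; apply/eqP.
  have := @tangent_section_reduced e u v 1 0 B ppu ppv ppe.
  rewrite /comb2 scale0r scale1r addr0; exact.
(* A square root of the discriminant of the cubic at [r *: u + v], a polynomial in [r] of degree 2
   since [T u u u = 0] and [T u u v != 0]. *)
have [d dE] := @closed_nth_root K 2 (9 * T u v v ^+ 2 - 12 * T u u v * T v v v)
  isT.
have dn0 : d != 0.
  (* [r] would be the double root, which [tangent_section_reduced] excludes. *)
  apply/eqP => d0; pose r := - T u v v / (2 * T u u v).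
  pose w := comb2 u v r 1.
  have disc0 : 3 * T u v v ^+ 2 = 4 * T u u v * T v v v.
    by apply: (mulfI n3); apply: (eq_lin1 (k := -1) dE); rewrite d0; ring.
  have w0 : w = 0.
    apply: (tangent_section_reduced B ppu ppv ppe).
      rewrite /comb2 scale1r !tE uuu (triC12 Tsym v u u) (triC23 Tsym u v u).
      rewrite (triC13 Tsym v v u) /r; field.
      by rewrite uuv n2.
    rewrite /comb2 scale1r !tE (triC12 Tsym v u v).
    apply: (mulfI (mulf_neq0 (natr_neq0 charK0 3) uuv)).
    apply: (eq_lin1 (k := - 1) disc0); rewrite /r; field.
    by rewrite uuv n2.
  have [|_ _ _ /eqP] := fr 0 0 r 1; last by rewrite oner_eq0.
  by rewrite -/w w0 /comb2 !scale0r !addr0.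
pose r1 := (- (3 * T u v v) + d) / (6 * T u u v).
pose r2 := (- (3 * T u v v) - d) / (6 * T u u v).
have n6 := natr_neq0 charK0 5.
exists e, u, v, r1, r2; split=> //.
  rewrite (inj_eq (divIf _)) ?mulf_neq0 // (inj_eq (addrI _)) -addr_eq0 -mulr2n.
  by rewrite -mulr_natl mulf_neq0.
have rP r : 6 * T u u v * r + 3 * T u v v = d \/ 6 * T u u v * r + 3 * T u v v
  = - d ->
    T (r *: u + v) (r *: u + v) (r *: u + v) = 0.
  move=> rd; have rd2 : (6 * T u u v * r + 3 * T u v v) ^+ 2 = d ^+ 2.
    by case: rd => ->; rewrite ?sqrrN.
  apply: (mulfI (mulf_neq0 (natr_neq0 charK0 11) uuv)).
  rewrite dE in rd2; rewrite (tri_cubeD Tsym) !tE uuu.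
  by apply: (eq_lin1 (k := 1) rd2); ring.
move=> w wl a b.
have [ppw www] : T p p w = 0 /\ T w w w = 0.
  move: wl; rewrite !inE => /or3P[] /eqP ->; split=> //.
  - by rewrite !tE ppu ppv; ring.
  - by apply: rP; left; rewrite /r1; field; rewrite uuv n6.
  - by rewrite !tE ppu ppv; ring.
  - by apply: rP; right; rewrite /r2; field; rewrite uuv n6.
rewrite (tri_cubeD Tsym) !tE ppp www ppw eckardt_polar //; ring.
Qed.
End Lines.
End EckardtVectorGeometry.

(** * Eckardt vectors and Eckardt points *)

Section CubicSurface.
Variable K : closedFieldType.
Hypothesis charK0 : [pchar K] =i pred0.
Variable T : 'cV[K]_4 -> 'cV[K]_4 -> 'cV[K]_4 -> K.
Hypotheses (Tsym : symmetric_trilinear T) (Tnd : nondegenerate T).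
Local Notation tE := (triE Tsym).
Local Notation V := 'cV[K]_4.

Definition cubic_points : set (proj_space K 3) :=
  [set q : proj_space K 3 | forall v : V, v \in val q -> T v v v = 0]%classic.

Lemma dim_line2 (p w : V) : free [:: p; w] -> \dim (<[p]> + <[w]>)%VS == 2%N.
Proof. by move/eqP; rewrite span_cons span_seq1 => ->. Qed.

Lemma mem_line2P (p w x : V) :
  reflect (exists a b, x = a *: p + b *: w) (x \in (<[p]> + <[w]>)%VS).
Proof.
apply: (iffP memv_addP) => [[_ /vlineP [a ->] [_ /vlineP [b ->] ->]]|[a
  [b ->]]].
  by exists a, b.
by exists (a *: p); rewrite ?rpredZ ?memv_line //; exists (b *: w);
  rewrite ?rpredZ ?memv_line.
Qed.

Lemma eckardt_point_of_vector p : eckardt_vector T p ->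
  exists q, Eckardt_point cubic_points q.
Proof.
move=> eck; have [e [u [v [s1 [s2 [[sp fr] s12 ppe f0]]]]]] :=
  tangent_section_three_lines charK0 Tsym Tnd eck.
have pn0 : p != 0 by case: eck.
have fr_p w s t : w = s *: u + t *: v -> s != 0 \/ t != 0 -> free [:: p; w].
  move=> wE st; rewrite free_cons seq1_free span_seq1; apply/andP; split.
    apply/vlineP => -[k pE].
    have [|/eqP] := fr 1 0 (- (k * s)) (- (k * t)); last by rewrite oner_eq0.
    rewrite /comb2 scale0r addr0 scale1r pE wE scalerDr !scalerA !scaleNr.
    by rewrite -opprD subrr.
  apply/eqP => w0; have [|_ _ s0 t0] := fr 0 0 s t.
    by rewrite /comb2 -wE w0 !scale0r !addr0.
  by case: st; rewrite ?s0 ?t0 eqxx.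
have one0 := oner_neq0 K.
have fu : free [:: p; u].
  by apply: (@fr_p _ 1 0); [rewrite scale1r scale0r addr0|left].
have fs s : free [:: p; s *: u + v].
  by apply: (@fr_p _ s 1); [rewrite scale1r|right].
pose l1 : proj_line K 3 := exist _ (<[p]> + <[u]>)%VS (dim_line2 fu).
pose l2 : proj_line K 3 := exist _ (<[p]> + <[s1 *: u + v]>)%VS
  (dim_line2 (fs s1)).
pose l3 : proj_line K 3 := exist _ (<[p]> + <[s2 *: u + v]>)%VS
  (dim_line2 (fs s2)).
have dimp : \dim <[p]>%VS == 1%N by rewrite dim_vline pn0.
pose q : proj_space K 3 := exist _ <[p]>%VS dimp.
have u_in : u \in val l1 by apply/mem_line2P; exists 0, 1;
  rewrite scale0r scale1r add0r.
have inS (w : V) (l : proj_line K 3) : val l = (<[p]> + <[w]>)%VS ->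
    w \in [:: u; s1 *: u + v; s2 *: u + v] ->
    (line_points l `<=` cubic_points)%classic.
  move=> lE wl r /= rl x xr; have := subvP rl _ xr; rewrite lE.
  by move=> /mem_line2P [a [b ->]]; apply: f0.
have comb_eq a b c a' b' c' : a *: p + (b *: u + c *: v) = a' *: p +
  (b' *: u + c' *: v) ->
    [/\ a = a', b = b' & c = c'].
  move=> E; have [|/eqP + _ /eqP + /eqP] := fr (a - a') 0 (b - b') (c - c').
    rewrite /comb2 scale0r addr0 !scalerBl [X in _ + X]addrACA -opprD.
    by rewrite addrACA -opprD E subrr.
  by rewrite !subr_eq0 => /eqP -> /eqP -> /eqP ->.
have lcomb a b s : a *: p + b *: (s *: u + v) = a *: p +
  ((b * s) *: u + b *: v).
  by rewrite scalerDr scalerA.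
have ucomb a b : a *: p + b *: u = a *: p + (b *: u + 0 *: v) by rewrite
  scale0r addr0.
have u_notin s : u \notin (<[p]> + <[s *: u + v]>)%VS.
  apply/negP => /mem_line2P [a [b]]; rewrite lcomb.
  rewrite -{1}[u]add0r -{1}(scale0r p) -{1}[u]scale1r ucomb =>
    /comb_eq [_ E b0].
  by move: one0; rewrite E -b0 mul0r eqxx.
exists q, l1, l2, l3; split; first split.
- by apply: contraNneq (u_notin s1) => /(congr1 val) /= <-.
- by apply: contraNneq (u_notin s2) => /(congr1 val) /= <-.
- apply: contraNneq s12 => /(congr1 val) /= E.
  have : s1 *: u + v \in (<[p]> + <[s2 *: u + v]>)%VS.
    by rewrite -E; apply/mem_line2P; exists 0, 1; rewrite scale0r scale1r add0r.
  move=> /mem_line2P [a [b]]; rewrite lcomb.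
  rewrite -{1}[s1 *: u + v]add0r -{1}(scale0r p) -{1}[v]scale1r =>
    /comb_eq [_ -> <-].
  by rewrite mul1r.
- by split; [apply: (inS u)|apply: (inS (s1 *: u + v))|apply:
  (inS (s2 *: u + v))];
    rewrite // !inE eqxx ?orbT.
(* The first two lines already meet only in [q]. *)
apply/seteqP; split=> [r [[/= r1 r2] _]|r ->] /=; last by do !split;
  apply: addvSl.
apply: val_inj; apply/eqP; rewrite eqEdim /= (eqP dimp) (eqP (valP r)) andbT.
apply/subvP => x xr; have := subvP r1 _ xr; have := subvP r2 _ xr.
move=> /mem_line2P [a [b ->]] /mem_line2P [a' [b']]; rewrite lcomb ucomb.
by move=> /comb_eq [_ _ ->]; rewrite mul0r !scale0r !addr0 rpredZ ?memv_line.
Qed.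

Lemma free_line2 (p w : V) (l : {vspace V}) : p != 0 -> \dim l = 2%N ->
  p \in l -> exists w, free [:: p; w] /\ l = (<[p]> + <[w]>)%VS.
Proof.
move=> pn0 dl pl; have [w0 w0l w0p] : exists2 w, w \in l & w \notin <[p]>%VS.
  apply/subvPn; apply/negP => /dimvS; rewrite dl dim_vline pn0 //.
have wp_free : free [:: w0; p] by rewrite free_cons span_seq1 w0p seq1_free.
have fr : free [:: p; w0] by rewrite (perm_free (_ : perm_eq _ [:: w0; p])) //
  (perm_catC [:: p] [:: w0]).
exists w0; split=> //; apply/esym/eqP;
  rewrite eqEdim dl (eqP (dim_line2 fr)) andbT.
by rewrite subv_add -!memvE pl w0l.
Qed.

(** Each line through [p] gives [w] with [T p p w = T p w w = 0]. The tangent plane is spanned by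
    [p], [w1], [w2], and there [T p x x] reduces to a multiple of [T p w1 w2]. The third line has
    nonzero coordinates along both [w1] and [w2], so it forces [T p w1 w2 = 0]. *)
Lemma eckardt_vector_of_point q : Eckardt_point cubic_points q ->
  exists p, eckardt_vector T p.
Proof.
move=> [l1 [l2 [l3 [[l12 l13 l23] [S1 S2 S3] lq]]]].
have : (line_points l1 `&` line_points l2 `&` line_points l3)%classic q by
  rewrite lq.
move=> [[q1 q2] q3]; rewrite /line_points /= in q1 q2 q3.
pose p := vpick (val q).
have pn0 : p != 0 by rewrite vpick0 -dimv_eq0 (eqP (valP q)).
have pq : p \in val q := memv_pick _.
have fl (l : proj_line K 3) : (line_points l `<=` cubic_points)%classic ->
    forall x, x \in val l -> T x x x = 0.
  move=> lS x xl; have [->|xn0] := eqVneq x 0; first by rewrite !tE.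
  have dimx : \dim <[x]>%VS == 1%N by rewrite dim_vline xn0.
  by apply: (lS (exist _ <[x]>%VS dimx)); rewrite /= ?memv_line // -memvE.
have line (l : proj_line K 3) : (val q <= val l)%VS ->
    (line_points l `<=` cubic_points)%classic ->
    exists w, [/\ free [:: p; w], val l = (<[p]> + <[w]>)%VS,
      T p p w = 0 & T p w w = 0].
  move=> ql /fl lS; have pl := subvP ql _ pq.
  have [w [fr lE]] := free_line2 p pn0 (eqP (valP l)) pl.
  exists w; have f0 s : T (p + s *: w) (p + s *: w) (p + s *: w) = 0.
    by apply: lS; rewrite lE; apply/mem_line2P; exists 1, s; rewrite scale1r.
  have www : T w w w = 0.
    by apply: lS; rewrite lE; apply/mem_line2P; exists 0, 1;
      rewrite scale0r scale1r add0r.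
  have ppp : T p p p = 0 by apply: lS.
  have n3 := natr_neq0 charK0 2.
  have [|_ E1 E2] := @quadratic_fun0 _ 0 (3 * T p p w) (3 * T p w w).
    move=> s; apply: etrans (f0 s); rewrite (tri_cubeD Tsym) !tE ppp www; ring.
  by split=> //; apply: (mulfI n3); rewrite mulr0.
have ppp : T p p p = 0 by apply: (fl l1) => //; apply: (subvP q1).
have [w1 [f1 l1E ppw1 pw1w1]] := line l1 q1 S1.
have [w2 [f2 l2E ppw2 pw2w2]] := line l2 q2 S2.
have [w3 [f3 l3E ppw3 pw3w3]] := line l3 q3 S3.
have [e ppe] := exists_polar_neq0 Tnd pn0.
have notin (l l' : proj_line K 3) w : val l = (<[p]> + <[w]>)%VS -> l != l' ->
    p \in val l' -> w \notin val l'.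
  move=> lE ll' pl'; apply: contra ll' => wl'; apply/eqP/val_inj/eqP.
  by rewrite eqEdim (eqP (valP l)) (eqP (valP l')) leqnn andbT lE subv_add
    -!memvE pl' wl'.
have p1 : p \in val l1 := subvP q1 _ pq;
  have p2 : p \in val l2 := subvP q2 _ pq.
have [l21 l31 l32] : [/\ l2 != l1, l3 != l1 & l3 != l2].
  by split; rewrite eq_sym.
have [sp _] : basis4 p e w1 w2.
  apply: basis4_of_free; apply/basis4P => a b c d E.
  have b0 : b = 0.
    have /eqP : b * T p p e = 0.
      have := congr1 (T p p) E; rewrite /comb2 !tE ppp ppw1 ppw2 => <-; ring.
    by rewrite mulf_eq0 (negPf ppe) orbF => /eqP.
  move: E; rewrite b0 /comb2 scale0r addr0 => E.
  have d0 : d = 0.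
    apply/eqP; apply: contraT => dn0.
    have /negP[] := notin l2 l1 w2 l2E l21 p1.
    rewrite l1E; apply/mem_line2P; exists (- (a / d)), (- (c / d)).
    apply: (scalerI dn0); rewrite scalerDr !scalerA !mulrN ![d * _]mulrC !divfK
      //.
    by apply/eqP; rewrite -subr_eq0 !scaleNr -opprD opprK addrC -addrA E.
  have {}E : a *: p + c *: w1 = 0 by rewrite -[RHS]E d0 scale0r addr0.
  have c0 : c = 0.
    apply/eqP; apply: contraT => cn0.
    have /negP[] := notin l1 l2 w1 l1E l12 p2; rewrite -(scalerK cn0 w1).
    rewrite rpredZ // -[c *: w1](addKr (a *: p)) E addr0 rpredN rpredZ //.
  move: E; rewrite c0 scale0r addr0 => /eqP;
    rewrite scaler_eq0 (negPf pn0) orbF.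
  by move/eqP=> a0; split.
have pw1w2 : T p w1 w2 = 0.
  have [a [b [c [d w3E]]]] := sp w3.
  have b0 : b = 0.
    have /eqP : b * T p p e = 0.
      by apply: etrans ppw3; rewrite w3E /comb2 !tE ppp ppw1 ppw2; ring.
    by rewrite mulf_eq0 (negPf ppe) orbF => /eqP.
  have cn0 : c != 0.
    apply/eqP => c0; have /negP[] := notin l3 l2 w3 l3E l32 p2.
    rewrite l2E; apply/mem_line2P; exists a, d.
    by rewrite w3E b0 c0 /comb2 !scale0r addr0 add0r.
  have dn0 : d != 0.
    apply/eqP => d0; have /negP[] := notin l3 l1 w3 l3E l31 p1.
    rewrite l1E; apply/mem_line2P; exists a, c.
    by rewrite w3E b0 d0 /comb2 !scale0r !addr0.
  have n2 := natr_neq0 charK0 1.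
  apply: (mulfI (mulf_neq0 n2 (mulf_neq0 cn0 dn0)));
    apply: (eq_lin1 (k := 1) pw3w3).
  rewrite w3E b0 /comb2 !tE pw1w1 pw2w2 (triC23 Tsym p w2 w1).
  rewrite (triC23 Tsym p w1 p) (triC23 Tsym p w2 p) ppp ppw1 ppw2; ring.
exists p; split=> // x; have [a [b [c [d ->]]]] := sp x.
rewrite /comb2 !tE ppp ppw1 ppw2 => E.
have /eqP : b * T p p e = 0 by apply: etrans E; ring.
rewrite mulf_eq0 (negPf ppe) orbF => /eqP ->.
rewrite pw1w1 pw2w2 (triC23 Tsym p w2 w1) pw1w2.
by rewrite (triC23 Tsym p w1 p) (triC23 Tsym p w2 p) ppw1 ppw2; ring.
Qed.

End CubicSurface.

(** * Reflections and the stabilizer *)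

Section Stabilizer.
Variable K : closedFieldType.
Hypothesis charK0 : [pchar K] =i pred0.
Variable T : 'cV[K]_4 -> 'cV[K]_4 -> 'cV[K]_4 -> K.
Hypotheses (Tsym : symmetric_trilinear T) (Tnd : nondegenerate T).
Local Notation tE := (triE Tsym).
Local Notation V := 'cV[K]_4.

(* On the line [x + s p] the cubic takes the value [f(x) + 3 s l m + 3 s^2 l],
   with [l = T p p x] and [T p x x = l m], hence it is preserved by the
   involution [x |-> x - m(x) p]. *)
Lemma eckardt_reflection p : eckardt_vector T p -> exists M : 'M[K]_4,
  [/\ M *m M = 1%:M, ~~ is_scalar_mx M &
    forall v, T (M *m v) (M *m v) (M *m v) = T v v v].
Proof.
move=> eck; have [pn0 ppp _] := eck.
have [e0 ppe0] := exists_polar_neq0 Tnd pn0.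
have [e ppe] : exists e, T p p e = 1.
  by exists ((T p p e0)^-1 *: e0); rewrite tE mulVf.
(* Write [x = h + l *: e] with [h] in the tangent plane and [l = T p p x]. Since [T p h h = 0],
   [T p x x] is [l] times this linear form. *)
pose m x := 2 * T p e x - T p p x * T p e e.
pose r : 'rV[K]_4 := 2 *: tri_row T p e - T p e e *: tri_row T p p.
have rE x : r *m x = (m x)%:M.
  apply/matrixP => i j; rewrite !ord1 /r mulmxBl -!scalemxAl mxE [in RHS]mxE
    eqxx.
  by rewrite [X in X + _]mxE [X in _ + X]mxE [X in _ - X]mxE !(tri_rowE Tsym)
    mulr1n /m; ring.
pose M : 'M[K]_4 := 1%:M - p *m r.
have Mx x : M *m x = x - m x *: p.
  by rewrite /M mulmxBl mul1mx -mulmxA rE mul_mx_scalar.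
(* This value makes the map an involution: [m] changes sign under it. *)
have mp : m p = 2 by rewrite /m (triC23 Tsym p e p) ppe ppp; ring.
have mD x y : m (x + y) = m x + m y by rewrite /m !tE; ring.
have mZ a x : m (a *: x) = a * m x by rewrite /m !tE; ring.
have pxx x : T p x x = T p p x * m x.
  set h := x - T p p x *: e.
  have h0 : T p p h = 0 by rewrite /h -scaleNr !tE ppe; ring.
  have hh := eckardt_polar charK0 Tsym eck h0 h0.
  have xE : x = h + T p p x *: e by rewrite /h subrK.
  move: (T p p x) xE => l xE; clearbody h.
  by rewrite xE /m !tE hh h0 ppe (triC23 Tsym p h e); ring.
exists M; split.
- suff MM j : col j (M *m M) = col j 1%:M :> V.
    by apply/matrixP => i j; have /colP/(_ i) := MM j; rewrite !mxE.
  rewrite !colE -mulmxA mul1mx; move: (delta_mx j 0 : V) => x.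
  rewrite !Mx -!scaleNr mD mZ mp -addrA -scalerDl.
  rewrite (_ : - m x + _ = 0) ?scale0r ?addr0 //; ring.
- apply/negP => /is_scalar_mxP [c ME].
  have := Mx p; rewrite ME mul_scalar_mx mp => /eqP.
  rewrite -[X in _ == X - _]scale1r -scalerBl -subr_eq0 -scalerBl scaler_eq0
    (negPf pn0) orbF.
  rewrite subr_eq0 => /eqP cE.
  have := congr1 (T p p) (Mx e);
    rewrite ME mul_scalar_mx -scaleNr !tE ppe ppp cE.
  move=> E; have /eqP := natr_neq0 charK0 1; apply.
  by apply: (eq_lin1 (k := -1) E); ring.
move=> v; rewrite Mx -scaleNr (tri_cubeD Tsym) !tE ppp.
by rewrite (triC13 Tsym v v p) (triC13 Tsym v p p) pxx; ring.
Qed.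

Lemma stab_of_cube_invariant (M : GL K 4) :
  (forall v, T (val M *m v) (val M *m v) (val M *m v) = T v v v) ->
  Stab (cubic_points T) (PGL_of M).
Proof.
move=> Minv; rewrite /Stab /=; apply/seteqP; split=> [_ [q qS <-]|q qS].
  by rewrite pgl_act_of => w /gl_actP [v qv ->]; rewrite Minv; apply: qS.
have MM : (PGL_of M * PGL_of (GL_inv M) = 1)%g.
  by apply: etrans (PGL_mulE _ _) _; congr PGL_of; exact: GL_mulgV.
exists (pgl_act (PGL_of (GL_inv M)) q); last by rewrite -pgl_actM MM pgl_act1.
rewrite pgl_act_of => w /gl_actP [v qv ->];
  rewrite -Minv mulmxA mulmxV ?mul1mx; last exact: Defs.GL_unit.
exact: qS.
Qed.

Lemma PGL_of_eq1 (M : GL K 4) : PGL_of M = 1%g -> is_scalar_mx (val M).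
Proof.
move/esym/PGL_of_eqP => [a E]; apply/is_scalar_mxP; exists a.
by rewrite E /= scalemx1.
Qed.

Lemma stab_nontrivial p : eckardt_vector T p ->
  exists2 g, Stab (cubic_points T) g & g != 1%g.
Proof.
move=> /eckardt_reflection [M [MM Mns Minv]].
have [Mu _] := mulmx1_unit MM.
pose A : GL K 4 := exist _ M Mu.
exists (PGL_of A); first exact: stab_of_cube_invariant.
by apply: contra Mns => /eqP /PGL_of_eq1.
Qed.

Lemma eckardt_vector_of_stab g : Stab (cubic_points T) g -> g != 1%g ->
  exists p, eckardt_vector T p.
Proof.
move=> gS gn1; pose A := val (repr g).
have Au : A \in unitmx := Defs.GL_unit _.
have sub v : T v v v = 0 -> T (A *m v) (A *m v) (A *m v) = 0.
  move=> v0; have [->|vn0] := eqVneq v 0; first by rewrite mulmx0 !tE.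
  have dimv : \dim <[v]>%VS == 1%N by rewrite dim_vline vn0.
  pose q : proj_space K 3 := exist _ <[v]>%VS dimv.
  have qS : cubic_points T q.
    by move=> w /vlineP [k ->]; rewrite (tri_cubeZ Tsym) v0 mulr0.
  have : cubic_points T (pgl_act g q) by rewrite -[cubic_points T]gS; exists q.
  by apply; apply: mem_gl_act; exact: memv_line.
pose T' x y z := T (A *m x) (A *m y) (A *m z).
have T'sym : symmetric_trilinear T'.
  split=> [a x y u v|x y z|x y z]; rewrite /T'.
  - by rewrite mulmxDr -scalemxAr !tE.
  - exact: triC12.
  - exact: triC23.
have [c cE] := proportional_of_zeros_sub charK0 Tsym Tnd T'sym sub.
have cn0 : c != 0.
  apply/eqP => c0.
  have T0 v : T v v v = 0.
    by have := cE (invmx A *m v); rewrite /T' mulmxA mulmxV // mul1mx c0 mul0r.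
  have T0' x y z : T x y z = 0.
    apply: (tri_cube_inj charK0 Tsym (T' := fun _ _ _ => 0)) => //.
    by split=> // *; rewrite mulr0 addr0.
  have /colP/(_ 0) : delta_mx 0 0 = 0 :> V by apply: Tnd => w.
  by rewrite !mxE !eqxx => /eqP; rewrite oner_eq0.
(* Rescaling [A] by [a] multiplies the cubic by [a^3], which cancels [c]. *)
have [a aE] := @closed_nth_root K 3 c^-1 isT.
have an0 : a != 0.
  apply/eqP => a0; move: aE; rewrite a0 expr0n => /esym/eqP.
  by rewrite invr_eq0 (negPf cn0).
have Minv : tri_invariant T (a *: A).
  pose T2 x y z := T (a *: A *m x) (a *: A *m y) (a *: A *m z).
  apply: (tri_cube_inj charK0 (T := T2) _ Tsym) => [|v].
    split=> [b x y u v|x y z|x y z]; rewrite /T2.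
    - by rewrite mulmxDr -[a *: A *m (b *: x)]scalemxAr !tE.
    - exact: triC12.
    - exact: triC23.
  by rewrite /T2 -scalemxAl (tri_cubeZ Tsym) -/(T' v v v) cE mulrA aE mulVf //
    mul1r.
apply: (eckardt_of_invariant charK0 Tsym Tnd _ Minv).
  by rewrite unitmxZ // unitfE.
apply: contra gn1 => /is_scalar_mxP [b bE].
rewrite -(PGL_ofK g); apply/eqP/esym/PGL_of_eqP; exists (a^-1 * b).
by rewrite /= -/A -[A](scalerK an0) bE -scalerA scalemx1.
Qed.

End Stabilizer.

Theorem theorem4p7 (K : closedFieldType) (charK0 : [pchar K] =i pred0)
    (S : set (proj_space K 3)) (smoothS : smooth_cubic_surface S) :
  (exists2 M : PGL K 4, Stab S M & M != 1%g) <->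
  (exists p : proj_space K 3, Eckardt_point S p).
Proof.
have [F [_ Fhom Fsm SF]] := smoothS.
have Tsym := polar_form_sym F.
have Tnd : nondegenerate (polar_form F) := smooth_nondegenerate charK0 Fhom Fsm.
have -> : S = cubic_points (polar_form F).
  rewrite SF; apply/seteqP; split=> q qF v qv.
    by rewrite -polar_form_cube //; apply: qF.
  by rewrite polar_form_cube //; apply: qF.
split=> [[g gS gn1]|[q /eckardt_vector_of_point [] // p eck]].
  have [p eck] := eckardt_vector_of_stab charK0 Tsym Tnd gS gn1.
  exact: eckardt_point_of_vector eck.
exact: stab_nontrivial eck.
Qed.
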